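(* Let $n\ge1$ be an integer, let $p>1$, $q>1$, $\alpha\ge0$ be constants, and let $\varphi(v)=v|v|^{p-2}$. Set $$\beta=\frac{p+\alpha}{q-p+1},\qquad \theta=2\beta(p-2)+\frac{4q\beta}{p-1},\qquad \gamma=(p-2)^2\beta^2+4q\beta^2,$$ $$a_0=\left[(n-p)\beta^{p-1}-(p-1)\beta^p\right]^{\frac{1}{q-p+1}}.$$ Assume that the conditions $$q>\frac{np-n+p+p\alpha}{n-p}\qquad\text{and}\qquad n-p<\frac{\theta+\sqrt{\theta^2-4\gamma}}{2}$$ hold (or that $\frac{pq+p+p\alpha}{q-p+1}<n<p+\frac{\theta+\sqrt{\theta^2-4\gamma}}{2}$ holds). Then the solution curve of the problem $$\varphi(u')'+\frac{n-1}{r}\varphi(u')+\lambda\,r^{\alpha}(1+u)^q=0\ \ \text{for } 0<r<1,\qquad u'(0)=u(1)=0,$$ makes infinitely many turns. Moreover, along this curve (as $u(0)\to\infty$), $\lambda\to\lambda_0=a_0^{\,q-1}$, and $u(r)$ tends to $r^{-\beta}-1$ for $r\ne0$, which is a singular solution of the differential equation above.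
   Context: Here $\lambda$ is a positive parameter and positive solutions $u=u(r)$ are considered. Let $w(t)$ be the solution of the initial value problem $\varphi(w')'+\frac{n-1}{t}\varphi(w')+t^{\alpha}w^q=0$, $w(0)=1$, $w'(0)=0$. The solution curve is the curve in the $(\lambda,u(0))$ plane given by $(\lambda,u(0))=\left(t^{p+\alpha}w^{q-p+1}(t),\ \frac{1}{w(t)}-1\right)$, parameterized by $t\in(0,\infty)$; the solution at the parameter value $t$ is $u(r)=\frac{w(tr)}{w(t)}-1$. That the curve makes infinitely many turns means that $\lambda(t)=t^{p+\alpha}w^{q-p+1}(t)$ changes its direction of monotonicity infinitely many times on $(0,\infty)$. A singular solution is one for which $u(r)\to\infty$ or $u'(r)\to\infty$ as $r\to0$.
   Formalization: The limit is stated as λ0 = a0^(q-p+1), since the printed a0^(q-1) is false unless p = 2 or a0 = 1; the tacit conditions n > p (in the first alternative) and q > p-1 (in the second), needed for a0 and the square root to make sense, are made explicit. *)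

(* Defs.v *)
From Stdlib Require Import Reals.
From Coquelicot Require Import Coquelicot.
Open Scope R_scope.

(* [Rpower x y] is the real power only for [x > 0].  All bases below are
   positive, except in [phi p 0], where the factor [v = 0] gives 0. *)
Definition phi (p v : R) : R := v * Rpower (Rabs v) (p - 2).

(* phi(v')' + (n-1)/r phi(v') + f = 0 at the point r, classically. *)
Definition radial_eq (n : nat) (p : R) (v f : R -> R) (r : R) : Prop :=
  locally r (fun s => ex_derive v s) /\
  ex_derive (fun s => phi p (Derive v s)) r /\
  Derive (fun s => phi p (Derive v s)) r
    + (INR n - 1) / r * phi p (Derive v r) + f r = 0.

(* One-sided, since solutions live on [0, b); includes right continuity at 0. *)
Definition right_derive_at_0 (v : R -> R) (l : R) : Prop :=
  filterlim (fun h => (v h - v 0) / h) (at_right 0) (locally l).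

(* w^q has a meaning only while w > 0, so the equation is imposed up to the
   first zero of w, if there is one; global positivity is not assumed. *)
Definition ivp_solution (n : nat) (p q alpha : R) (w : R -> R) : Prop :=
  w 0 = 1 /\
  right_derive_at_0 w 0 /\
  (forall t, 0 < t -> continuous w t) /\
  (forall t, 0 < t -> (forall s, 0 <= s <= t -> 0 < w s) ->
     radial_eq n p w (fun s => Rpower s alpha * Rpower (w s) q) t).

Definition de_solution (n : nat) (p q alpha lam : R) (u : R -> R) : Prop :=
  forall r, 0 < r < 1 ->
    0 < u r /\
    radial_eq n p u (fun s => lam * Rpower s alpha * Rpower (1 + u s) q) r.

Definition bvp_solution (n : nat) (p q alpha lam : R) (u : R -> R) : Prop :=
  0 < lam /\
  de_solution n p q alpha lam u /\
  0 < u 0 /\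
  right_derive_at_0 u 0 /\
  u 1 = 0 /\
  filterlim u (at_left 1) (locally (u 1)).

Definition singular_solution (n : nat) (p q alpha lam : R) (u : R -> R) : Prop :=
  de_solution n p q alpha lam u /\
  (filterlim u (at_right 0) (Rbar_locally p_infty) \/
   filterlim (Derive u) (at_right 0) (Rbar_locally p_infty)).

Definition curve_lambda (p q alpha : R) (w : R -> R) (t : R) : R :=
  Rpower t (p + alpha) * Rpower (w t) (q - p + 1).

Definition curve_u0 (w : R -> R) (t : R) : R := 1 / w t - 1.

Definition curve_u (w : R -> R) (t r : R) : R := w (t * r) / w t - 1.

Definition incr_on (f : R -> R) (a b : R) : Prop :=
  forall x y, a <= x -> x < y -> y <= b -> f x < f y.

Definition decr_on (f : R -> R) (a b : R) : Prop :=
  forall x y, a <= x -> x < y -> y <= b -> f y < f x.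

Definition turns_at (f : R -> R) (t : R) : Prop :=
  exists e, 0 < e /\
    ((incr_on f (t - e) t /\ decr_on f t (t + e)) \/
     (decr_on f (t - e) t /\ incr_on f t (t + e))).

Definition infinitely_many_turns (f : R -> R) : Prop :=
  exists tau : nat -> R,
    (forall j k, tau j = tau k -> j = k) /\
    (forall k, 0 < tau k /\ turns_at f (tau k)).

(* The filter "u(0) -> +oo" on the curve parameter t in (0,+oo). *)
Definition u0_to_infty (w : R -> R) (P : R -> Prop) : Prop :=
  exists M, forall t, 0 < t -> M < curve_u0 w t -> P t.

Definition beta (p q alpha : R) : R := (p + alpha) / (q - p + 1).

Definition theta (p q alpha : R) : R :=
  2 * beta p q alpha * (p - 2) + 4 * q * beta p q alpha / (p - 1).

Definition gamma (p q alpha : R) : R :=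
  (p - 2) ^ 2 * beta p q alpha ^ 2 + 4 * q * beta p q alpha ^ 2.

Definition a0 (n : nat) (p q alpha : R) : R :=
  Rpower ((INR n - p) * Rpower (beta p q alpha) (p - 1)
          - (p - 1) * Rpower (beta p q alpha) p)
         (1 / (q - p + 1)).

(* The source prints the exponent q - 1, which agrees with this one when p = 2.
   In general a0 t^(-beta) solves the equation for w, and inserting it in
   lambda = t^(p+alpha) w^(q-p+1) gives a0^(q-p+1), the only value of lambda
   for which r^(-beta) - 1 solves the equation for u. *)
Definition lambda0 (n : nat) (p q alpha : R) : R :=
  Rpower (a0 n p q alpha) (q - p + 1).

(* Main.v *)
Require Import Defs.
From Stdlib Require Import Reals Lra Lia ClassicalEpsilon.
From Coquelicot Require Import Coquelicot.
Open Scope R_scope.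

(** Put [b = beta], [k = n - p - b (p - 1)] and pass to logarithmic time
    [t = exp s].  With
      [Y = t^b w]  and  [Z = t^((b+1)(p-1)) |w'|^(p-1)]
    the radial equation becomes the planar autonomous system
      [Y' = b Y - Z^(1/(p-1))],  [Z' = Y^q - k Z],
    whose only equilibrium with [Y > 0] is [Y = a], [Z = (b a)^(p-1)], where
    [a = a0] and [a^(q-p+1) = k b^(p-1)].  On the curve
    [lambda = Y^(q-p+1)], so everything is a statement about one orbit of this
    system, the one that leaves the origin as [s -> -oo].

    The lower bound on [n] or [q] says that [b < k], and together with it the
    upper bound on [n] says that [(b + k)^2 < 4 b k q / (p - 1)], i.e. that the
    linearisation at the equilibrium has non-real eigenvalues
    ([admissible_parameters]).

    Since [b < k], the Pohozaev-type function [energy] decreases along orbits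
    ([flow_energy]).  It is negative at arbitrarily early times, where [Y] is small, hence always
    ([energy_negative]), and negative energy keeps [Y] between two positive
    constants ([energy_confines]).  This is also what prevents [w] from
    vanishing ([ivp_global_positivity]).  Adding a small cross term to the energy
    makes it a strict Lyapunov function, so the orbit converges to the
    equilibrium ([orbit_converges]): this gives the limits of [lambda] and of
    [u], because [u + 1 = w(tr) / w(t)] tends to [r^(-b)].

    For the turns, the slope [(Z - (b a)^(p-1)) / (Y - a)] satisfies near the
    equilibrium a Riccati inequality without real roots, so it blows up in finite
    time and [Y] takes the value [a] at arbitrarily large times
    ([orbit_meets_level]).  Between two such times [|Y - a|] has a positive
    maximum ([orbit_stationary]), and there [Y' = 0] while [Z' <> 0], so that
    [Y] changes its direction of monotonicity ([stationary_turns]). *)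

(** * Real powers *)

Lemma Rpower_pos x a : 0 < Rpower x a.
Proof. apply exp_pos. Qed.

Lemma Rpower_base_1 e : Rpower 1 e = 1.
Proof. unfold Rpower. rewrite ln_1, Rmult_0_r. apply exp_0. Qed.

Lemma Rpower_S x a : 0 < x -> Rpower x (a + 1) = x * Rpower x a.
Proof. intros hx. rewrite Rpower_plus, (Rpower_1 x hx). ring. Qed.

Lemma Rpower_exp x s : Rpower (exp s) x = exp (x * s).
Proof. unfold Rpower. rewrite ln_exp. reflexivity. Qed.

Lemma exp_le x y : x <= y -> exp x <= exp y.
Proof. intros [h| ->]; [apply Rlt_le, exp_increasing, h|apply Rle_refl]. Qed.

Lemma Rpower_root e x : 0 < x -> e <> 0 -> Rpower (Rpower x (1 / e)) e = x.
Proof.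
  intros hx he. rewrite Rpower_mult. replace (1 / e * e) with 1 by (field; exact he).
  apply Rpower_1, hx.
Qed.

Lemma Rpower_root' e x : 0 < x -> e <> 0 -> Rpower (Rpower x e) (1 / e) = x.
Proof.
  intros hx he. rewrite Rpower_mult. replace (e * (1 / e)) with 1 by (field; exact he).
  apply Rpower_1, hx.
Qed.

Lemma Rpower_strict_mono e u v : 0 < e -> 0 < u -> 0 < v -> (u < v <-> Rpower u e < Rpower v e).
Proof.
  intros he hu hv. split; intros h.
  - apply Rlt_Rpower_l; lra.
  - destruct (Rlt_dec u v) as [|hn]; [assumption|].
    pose proof (Rle_Rpower_l v u e ltac:(lra) ltac:(lra)). lra.
Qed.

Lemma is_derive_Rpower (f : R -> R) (x l a : R) :
  0 < f x -> is_derive f x l ->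
  is_derive (fun s => Rpower (f s) a) x (a * Rpower (f x) (a - 1) * l).
Proof.
  intros hf hd.
  rewrite Rmult_comm.
  apply (is_derive_comp (fun y => Rpower y a) f x (a * Rpower (f x) (a - 1)) l); [|exact hd].
  apply is_derive_Reals, derivable_pt_lim_power, hf.
Qed.

Lemma Rpower_continuity (e x0 eps : R) : 0 < x0 -> 0 < eps ->
  exists d, 0 < d /\ forall x, Rabs (x - x0) < d -> Rabs (Rpower x e - Rpower x0 e) < eps.
Proof.
  intros hx heps.
  assert (hc : continuous (fun x => Rpower x e) x0).
  { apply (ex_derive_continuous (V := R_NormedModule)). eexists.
    apply is_derive_Reals, derivable_pt_lim_power, hx. }
  destruct (proj1 (filterlim_locally _ _) hc (mkposreal eps heps)) as [d hd].
  exists d. split; [apply cond_pos|]. intros x hxd. apply (hd x). exact hxd.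
Qed.

Lemma Rpower_mean_value (e u v : R) :
  0 < u -> 0 < v ->
  exists c, Rmin u v <= c <= Rmax u v /\
    Rpower u e - Rpower v e = e * Rpower c (e - 1) * (u - v).
Proof.
  intros hu hv.
  destruct (MVT_gen (fun x => Rpower x e) v u (fun x => e * Rpower x (e - 1))) as [c [hc h]].
  - intros x hx. apply is_derive_Reals, derivable_pt_lim_power.
    assert (0 < Rmin v u) by (apply Rmin_glb_lt; lra). lra.
  - intros x hx. apply derivable_continuous_pt. exists (e * Rpower x (e - 1)).
    apply derivable_pt_lim_power.
    assert (0 < Rmin v u) by (apply Rmin_glb_lt; lra). lra.
  - exists c. rewrite Rmin_comm, Rmax_comm. split; [exact hc|exact h].
Qed.

Lemma Rpower_between (e a b x : R) :
  0 < a -> a <= x <= b ->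
  Rmin (Rpower a e) (Rpower b e) <= Rpower x e <= Rmax (Rpower a e) (Rpower b e).
Proof.
  intros ha hx. destruct (Rle_dec 0 e) as [he|he].
  - split.
    + eapply Rle_trans; [apply Rmin_l|]. apply Rle_Rpower_l; lra.
    + eapply Rle_trans; [|apply Rmax_r]. apply Rle_Rpower_l; lra.
  - assert (H : forall u v, 0 < u <= v -> Rpower v e <= Rpower u e).
    { intros u v huv. replace e with (- (- e)) by ring.
      rewrite (Rpower_Ropp v), (Rpower_Ropp u).
      apply Rinv_le_contravar; [apply Rpower_pos|]. apply Rle_Rpower_l; lra. }
    split.
    + eapply Rle_trans; [apply Rmin_r|]. apply H; lra.
    + eapply Rle_trans; [|apply Rmax_l]. apply H; lra.
Qed.

(** On a compact subinterval of [(0, +oo)] a difference of powers is a linear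
    term whose coefficient is bounded above and away from [0]; the nonlinear
    estimates below become linear ones in this way. *)
Lemma Rpower_slope_bounds (e a b : R) :
  0 < e -> 0 < a ->
  exists c L, 0 < c /\ 0 < L /\ forall u v, a <= u <= b -> a <= v <= b ->
    exists m, c <= m <= L /\ Rpower u e - Rpower v e = m * (u - v).
Proof.
  intros he ha.
  exists (e * Rmin (Rpower a (e - 1)) (Rpower b (e - 1))),
         (e * Rmax (Rpower a (e - 1)) (Rpower b (e - 1))).
  assert (0 < Rmin (Rpower a (e - 1)) (Rpower b (e - 1)))
    by (apply Rmin_glb_lt; apply Rpower_pos).
  assert (Rmin (Rpower a (e - 1)) (Rpower b (e - 1)) <= Rmax (Rpower a (e - 1)) (Rpower b (e - 1)))
    by (eapply Rle_trans; [apply Rmin_l|apply Rmax_l]).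
  split; [|split].
  - apply Rmult_lt_0_compat; lra.
  - apply Rmult_lt_0_compat; lra.
  - intros u v hu hv. destruct (Rpower_mean_value e u v) as [c [hc h]]; [lra|lra|].
    exists (e * Rpower c (e - 1)). split; [|exact h].
    assert (a <= c <= b).
    { assert (a <= Rmin u v) by (apply Rmin_glb; lra).
      assert (Rmax u v <= b) by (apply Rmax_lub; lra). lra. }
    destruct (Rpower_between (e - 1) a b c ha ltac:(lra)).
    split; apply Rmult_le_compat_l; lra.
Qed.

(** Linearisation at [u0] without remainder term: the coefficient depends on
    [u], but is close to the derivative. *)
Lemma Rpower_slope_near (e u0 eps : R) :
  0 < u0 -> 0 < eps ->
  exists d, 0 < d /\ forall u, 0 < u -> Rabs (u - u0) < d ->
    exists m, Rabs (m - e * Rpower u0 (e - 1)) < eps /\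
      Rpower u e - Rpower u0 e = m * (u - u0).
Proof.
  intros hu0 heps.
  assert (hc : continuous (fun x => e * Rpower x (e - 1)) u0).
  { apply (ex_derive_continuous (V := R_NormedModule)).
    exists (e * ((e - 1) * Rpower u0 (e - 1 - 1) * 1)).
    apply (is_derive_scal (fun x => Rpower x (e - 1))).
    apply (is_derive_Rpower (fun x => x) u0 1); [exact hu0|]. apply is_derive_Reals, derivable_pt_lim_id. }
  pose proof (proj1 (filterlim_locally _ _) hc (mkposreal eps heps)) as [d hd].
  exists d. split; [apply cond_pos|].
  intros u hu hud. destruct (Rpower_mean_value e u u0 hu hu0) as [c [hcb h]].
  exists (e * Rpower c (e - 1)). split; [|exact h].
  apply (hd c). change (Rabs (c - u0) < d).
  eapply Rle_lt_trans; [|exact hud].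
  revert hcb. unfold Rmin, Rmax. destruct (Rle_dec u u0); intros hcb;
  unfold Rabs; repeat destruct Rcase_abs; lra.
Qed.

(** Convexity of the power, which is Young's inequality in the form needed to
    minimise [energy] over its second argument. *)
Lemma Rpower_tangent p u x :
  1 < p -> 0 < u -> 0 < x ->
  p * Rpower x (p - 1) * (u - x) <= Rpower u p - Rpower x p.
Proof.
  intros hp hu hx. destruct (Rpower_mean_value p u x hu hx) as [c [hc ->]].
  rewrite !Rmult_assoc. apply Rmult_le_compat_l; [lra|].
  destruct (Rle_dec x u) as [hxu|hxu].
  - rewrite Rmin_right, Rmax_left in hc by lra.
    apply Rmult_le_compat_r; [lra|]. apply Rle_Rpower_l; lra.
  - rewrite Rmin_left, Rmax_right in hc by lra.
    assert (Rpower c (p - 1) <= Rpower x (p - 1)) by (apply Rle_Rpower_l; lra).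
    nra.
Qed.

(** * Derivatives and differential inequalities *)

Lemma Derive_eq (f : R -> R) x l : is_derive f x l -> Derive (fun x => f x) x = l.
Proof. apply is_derive_unique. Qed.

Lemma continuity_of_derive (f : R -> R) (l : R) s : is_derive f s l -> continuity_pt f s.
Proof.
  intros h. apply derivable_continuous_pt. exists l. apply is_derive_Reals, h.
Qed.

Lemma mean_value (f df : R -> R) (a b : R) :
  a < b -> (forall x, a <= x <= b -> is_derive f x (df x)) ->
  exists c, f b - f a = df c * (b - a) /\ a < c < b.
Proof.
  intros hab hd. apply MVT_cor2; [exact hab|].
  intros c hc. apply is_derive_Reals, hd, hc.
Qed.

Lemma strict_incr_of_derive (f df : R -> R) (a b : R) :
  a < b -> (forall x, a <= x <= b -> is_derive f x (df x)) ->
  (forall x, a < x < b -> 0 < df x) -> f a < f b.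
Proof.
  intros hab hd hp. destruct (mean_value f df a b hab hd) as [c [h hc]].
  specialize (hp c hc). assert (0 < df c * (b - a)) by (apply Rmult_lt_0_compat; lra). lra.
Qed.

Lemma nonincr_of_derive (f df : R -> R) (a b : R) :
  a <= b -> (forall x, a <= x <= b -> is_derive f x (df x)) ->
  (forall x, a <= x <= b -> df x <= 0) -> f b <= f a.
Proof.
  intros hab hd hp. destruct (Req_dec a b) as [->|hne]; [lra|].
  destruct (mean_value f df a b ltac:(lra) hd) as [c [h hc]].
  specialize (hp c ltac:(lra)).
  assert (0 <= - df c * (b - a)) by (apply Rmult_le_pos; lra). lra.
Qed.

Lemma stationary_of_maximum (f : R -> R) (l a0 b0 c : R) :
  is_derive f c l -> a0 < c < b0 -> (forall x, a0 < x < b0 -> f x <= f c) -> l = 0.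
Proof.
  intros hd hc hmax. apply is_derive_Reals in hd.
  pose proof (deriv_maximum f a0 b0 c (exist _ l hd) (proj1 hc) (proj2 hc)
    (fun x h1 h2 => hmax x (conj h1 h2))) as h. exact h.
Qed.

Lemma sign_near_simple_zero (h : R -> R) (s l : R) :
  is_derive h s l -> l < 0 -> h s = 0 ->
  exists e, 0 < e /\ forall x, (s - e <= x < s -> 0 < h x) /\ (s < x <= s + e -> h x < 0).
Proof.
  intros hd hl h0. apply is_derive_Reals in hd.
  destruct (hd (- l) ltac:(lra)) as [d hdd].
  pose proof (cond_pos d).
  exists (d / 2). split; [lra|].
  assert (H1 : forall x, x <> s -> Rabs (x - s) < d -> h x / (x - s) < 0).
  { intros x hx hxd. specialize (hdd (x - s) ltac:(lra) hxd).
    replace (s + (x - s)) with x in hdd by ring. rewrite h0, Rminus_0_r in hdd.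
    apply Rabs_def2 in hdd. lra. }
  intros x. split; intros hx.
  - specialize (H1 x ltac:(lra) ltac:(apply Rabs_def1; lra)).
    replace (h x) with (h x / (x - s) * (x - s)) by (field; lra). nra.
  - specialize (H1 x ltac:(lra) ltac:(apply Rabs_def1; lra)).
    replace (h x) with (h x / (x - s) * (x - s)) by (field; lra). nra.
Qed.

(** The integrating factor [exp (k s)] makes [Z - C] monotone. *)
Lemma linear_upper_bound (k C : R) (Z F : R -> R) (a b : R) :
  a <= b ->
  (forall s, a <= s <= b -> is_derive Z s (F s - k * Z s)) ->
  (forall s, a <= s <= b -> F s <= k * C) ->
  Z a <= C -> Z b <= C.
Proof.
  intros hab hZ hF ha.
  assert (h : (Z b - C) * exp (k * b) <= (Z a - C) * exp (k * a)).
  { apply (nonincr_of_derive (fun s => (Z s - C) * exp (k * s))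
             (fun s => (F s - k * C) * exp (k * s))); [exact hab| |].
    - intros s hs. auto_derive; [exists (F s - k * Z s); apply hZ, hs|].
      replace (Derive (fun x => Z x) s) with (F s - k * Z s)
        by (symmetry; apply is_derive_unique, hZ, hs). ring.
    - intros s hs. specialize (hF s hs). pose proof (exp_pos (k * s)). nra. }
  pose proof (exp_pos (k * a)). pose proof (exp_pos (k * b)). nra.
Qed.

(** For a squared distance [N] this gives backward uniqueness: if [N] vanishes
    at [b], it vanishes at all earlier times. *)
Lemma backward_gronwall (N dN : R -> R) (K a b : R) :
  a <= b ->
  (forall s, a <= s <= b -> is_derive N s (dN s)) ->
  (forall s, a <= s <= b -> - K * N s <= dN s) ->
  N a * exp (K * a) <= N b * exp (K * b).
Proof.
  intros hab hN hdN.
  assert (- (N b * exp (K * b)) <= - (N a * exp (K * a))); [|lra].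
  apply (nonincr_of_derive (fun s => - (N s * exp (K * s)))
           (fun s => - ((dN s + K * N s) * exp (K * s)))); [exact hab| |].
  - intros s hs. auto_derive; [exists (dN s); apply hN, hs|].
    replace (Derive (fun x => N x) s) with (dN s) by (symmetry; apply is_derive_unique, hN, hs). ring.
  - intros s hs. specialize (hdN s hs).
    assert (0 <= (dN s + K * N s) * exp (K * s)); [|lra].
    apply Rmult_le_pos; [lra|apply Rlt_le, exp_pos].
Qed.

(** Barbalat's argument.  As [W] is nonincreasing and bounded below, it
    eventually cannot lose a fixed amount [d] any more.  But if [|f|] is at least
    [eps] at some time, then the bound on [f'] keeps it above [eps / 2] for a time
    [h], during which [W] loses at least [d]. *)
Lemma dissipation_tendsto_zero (W dW f df : R -> R) (s0 c M B : R) :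
  0 < c -> 0 < M ->
  (forall s, s0 <= s -> is_derive W s (dW s)) ->
  (forall s, s0 <= s -> dW s <= - c * f s ^ 2) ->
  (forall s, s0 <= s -> B <= W s) ->
  (forall s, s0 <= s -> is_derive f s (df s)) ->
  (forall s, s0 <= s -> Rabs (df s) <= M) ->
  forall eps, 0 < eps -> exists S, s0 <= S /\ forall s, S <= s -> Rabs (f s) < eps.
Proof.
  intros hc hM hW hdW hB hf hdf eps heps.
  set (h := eps / (2 * M)).
  set (d := c * (eps / 2) ^ 2 * h).
  assert (hh : 0 < h) by (apply Rdiv_lt_0_compat; lra).
  assert (hd : 0 < d).
  { apply Rmult_lt_0_compat; [|lra]. apply Rmult_lt_0_compat; [lra|].
    apply pow_lt; lra. }
  assert (mono : forall s t, s0 <= s -> s <= t -> W t <= W s).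
  { intros s t hs hst. apply nonincr_of_derive with dW; [lra| |].
    - intros x hx; apply hW; lra.
    - intros x hx. specialize (hdW x ltac:(lra)).
      assert (0 <= c * f x ^ 2) by (apply Rmult_le_pos; [lra|apply pow2_ge_0]). lra. }
  assert (hS : exists S, s0 <= S /\ forall s, S <= s -> W S - d < W s).
  { apply Classical_Prop.NNPP. intros hno.
    assert (hstep : forall k : nat, exists s, s0 <= s /\ W s <= W s0 - INR k * d).
    { induction k as [|k [s [hs hk]]].
      - exists s0. simpl. lra.
      - assert (exists t, s <= t /\ W t <= W s - d) as [t [ht hWt]].
        { apply Classical_Prop.NNPP. intros hno'. apply hno. exists s. split; [exact hs|].
          intros t ht. apply Rnot_le_lt. intros hle. apply hno'. exists t. split; [exact ht|exact hle]. }
        exists t. rewrite S_INR. split; lra. }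
    destruct (INR_unbounded ((W s0 - B) / d)) as [k hk].
    destruct (hstep k) as [s [hs hWs]]. specialize (hB s hs).
    apply Rlt_div_l in hk; lra. }
  destruct hS as [S [hS0 hS]]. exists S. split; [exact hS0|].
  intros s hs. apply Rnot_le_lt. intros hge.
  assert (hlow : forall t, s <= t <= s + h -> eps / 2 <= Rabs (f t)).
  { intros t ht. destruct (MVT_gen f s t df) as [x [hx hfx]].
    - intros x hx. apply hf. rewrite Rmin_left in hx by lra. lra.
    - intros x hx. apply derivable_continuous_pt. exists (df x).
      apply is_derive_Reals, hf. rewrite Rmin_left in hx by lra. lra.
    - rewrite Rmin_left, Rmax_right in hx by lra.
      assert (Rabs (f t - f s) <= eps / 2).
      { rewrite hfx, Rabs_mult, (Rabs_pos_eq (t - s)) by lra.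
        replace (eps / 2) with (M * h) by (unfold h; field; lra).
        apply Rmult_le_compat; [apply Rabs_pos|lra|apply hdf; lra|lra]. }
      pose proof (Rabs_triang_inv (f s) (f s - f t)) as htri.
      rewrite (Rabs_minus_sym (f s) (f t)) in htri.
      replace (f s - (f s - f t)) with (f t) in htri by ring. lra. }
  destruct (mean_value W dW s (s + h)) as [x [hx hxs]]; [lra| |].
  { intros x hx; apply hW; lra. }
  specialize (hdW x ltac:(lra)). specialize (hS (s + h) ltac:(lra)).
  specialize (mono S s hS0 hs).
  specialize (hlow x ltac:(lra)).
  assert ((eps / 2) ^ 2 <= f x ^ 2).
  { rewrite <- (pow2_abs (f x)). apply pow_incr. lra. }
  assert (c * (eps / 2) ^ 2 <= c * f x ^ 2) by (apply Rmult_le_compat_l; lra).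
  assert (dW x * h <= - (c * (eps / 2) ^ 2) * h) by (apply Rmult_le_compat_r; lra).
  replace (s + h - s) with h in hx by ring. unfold d in hS. lra.
Qed.

(** The derivative of [atan (r - h)] would be at least [c] forever. *)
Lemma riccati_no_global_solution (r dr : R -> R) (s0 h c : R) :
  0 < c ->
  (forall s, s0 <= s -> is_derive r s (dr s)) ->
  (forall s, s0 <= s -> c * (1 + (r s - h) ^ 2) <= dr s) -> False.
Proof.
  intros hc hr hdr.
  set (A := fun s => atan (r s - h)).
  set (dA := fun s => dr s / (1 + (r s - h) ^ 2)).
  assert (hA : forall s, s0 <= s -> is_derive A s (dA s)).
  { intros s hs. unfold A, dA, Rdiv.
    apply (is_derive_comp atan (fun s => r s - h) s (/ (1 + (r s - h) ^ 2)) (dr s)).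
    - apply is_derive_Reals, derivable_pt_lim_atan.
    - replace (dr s) with (dr s - 0) by ring.
      apply (is_derive_minus r (fun _ => h) s (dr s) 0); [apply hr, hs|].
      apply is_derive_Reals, derivable_pt_lim_const. }
  pose proof PI_RGT_0 as hpi.
  assert (hpos : 0 < PI / c) by (apply Rdiv_lt_0_compat; lra).
  destruct (mean_value A dA s0 (s0 + PI / c)) as [x [hx hxs]]; [lra| |].
  { intros x hx. apply hA; lra. }
  assert (hcx : c <= dA x).
  { unfold dA. pose proof (pow2_ge_0 (r x - h)). apply Rle_div_r; [lra|]. apply hdr; lra. }
  replace (s0 + PI / c - s0) with (PI / c) in hx by ring.
  assert (PI <= dA x * (PI / c)).
  { replace PI with (c * (PI / c)) at 1 by (field; lra). apply Rmult_le_compat_r; lra. }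
  pose proof (atan_bound (r (s0 + PI / c) - h)). pose proof (atan_bound (r s0 - h)).
  unfold A in hx. lra.
Qed.

Lemma injective_sequence_of_unbounded (P : R -> Prop) :
  (forall S, exists s, S < s /\ P s) ->
  exists tau : nat -> R, (forall j k, tau j = tau k -> j = k) /\ forall k, P (tau k).
Proof.
  intros H.
  set (next := fun S => proj1_sig (constructive_indefinite_description _ (H S))).
  assert (hnext : forall S, S < next S /\ P (next S)).
  { intros S. unfold next. apply proj2_sig. }
  set (tau := fix tau k := match k with O => next 0 | Datatypes.S k => next (tau k) end).
  assert (hstep : forall j i, tau j < tau (Datatypes.S (i + j))).
  { intros j i. induction i as [|i IH]; simpl; [apply hnext|].
    eapply Rlt_trans; [exact IH|apply hnext]. }
  assert (hlt : forall j k, (j < k)%nat -> tau j < tau k).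
  { intros j k hjk. replace k with (Datatypes.S ((k - j - 1) + j)) by lia. apply hstep. }
  exists tau. split.
  - intros j k e. destruct (Nat.lt_trichotomy j k) as [h|[h|h]]; [|exact h|];
      apply hlt in h; lra.
  - intros [|k]; apply hnext.
Qed.

(** * The autonomous system in logarithmic time *)

Section System.

Variables p q b k : R.
Hypotheses (hp : 1 < p) (hq : p - 1 < q) (hb : 0 < b) (hbk : b < k).

(** The radial equation in the variables [Y = t^b w],
    [Z = t^((b+1)(p-1)) |w'|^(p-1)] with [s = ln t], imposed at one time only,
    because [w] is not known to stay positive at first. *)
Definition flow (Y Z : R -> R) (s : R) : Prop :=
  0 < Y s /\ 0 < Z s /\
  is_derive Y s (b * Y s - Rpower (Z s) (1 / (p - 1))) /\
  is_derive Z s (Rpower (Y s) q - k * Z s).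

(** The first three terms form a Hamiltonian [H] with [dH/dz = - Y'] and
    [dH/dy = Z' + (k - b) z].  Its derivative along the flow is
    [(k - b) Z Y'], which has no sign; the last term replaces [Z] there by
    [Z - (b Y)^(p-1)], and this has the sign of [- Y']. *)
Definition energy (y z : R) : R :=
  Rpower y (q + 1) / (q + 1) + (p - 1) / p * Rpower z (p / (p - 1)) - b * y * z
  - (k - b) * Rpower b (p - 1) * Rpower y p / p.

Lemma flow_energy (Y Z : R -> R) (s : R) :
  flow Y Z s ->
  is_derive (fun s => energy (Y s) (Z s)) s
    (- (k - b) * (b * Y s - Rpower (Z s) (1 / (p - 1)))
       * (Rpower (b * Y s) (p - 1) - Z s)).
Proof.
  intros [hY [hZ [dY dZ]]]. unfold energy.
  pose proof (is_derive_Rpower Y s _ (q + 1) hY dY) as d1.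
  pose proof (is_derive_Rpower Z s _ (p / (p - 1)) hZ dZ) as d2.
  pose proof (is_derive_Rpower Y s _ p hY dY) as d3.
  rewrite <- (Rpower_mult_distr b (Y s)) by assumption.
  replace (q + 1 - 1) with q in d1 by ring.
  replace (p / (p - 1) - 1) with (1 / (p - 1)) in d2 by (field; lra).
  set (X := Rpower (Z s) (1 / (p - 1))) in *.
  change (is_derive (fun s => (fun s => Rpower (Y s) (q + 1)) s / (q + 1)
    + (p - 1) / p * (fun s => Rpower (Z s) (p / (p - 1))) s - b * Y s * Z s
    - (k - b) * Rpower b (p - 1) * (fun s => Rpower (Y s) p) s / p) s
    (- (k - b) * (b * Y s - X) * (Rpower b (p - 1) * Rpower (Y s) (p - 1) - Z s))).
  set (P1 := fun s => Rpower (Y s) (q + 1)).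
  set (P2 := fun s => Rpower (Z s) (p / (p - 1))).
  set (P3 := fun s => Rpower (Y s) p).
  change (is_derive P1 s ((q + 1) * Rpower (Y s) q * (b * Y s - X))) in d1.
  change (is_derive P2 s (p / (p - 1) * X * (Rpower (Y s) q - k * Z s))) in d2.
  change (is_derive P3 s (p * Rpower (Y s) (p - 1) * (b * Y s - X))) in d3.
  auto_derive.
  - repeat split; eexists; eassumption.
  - change (Derive (fun x => P1 x) s) with (Derive P1 s).
    change (Derive (fun x => P2 x) s) with (Derive P2 s).
    change (Derive (fun x => P3 x) s) with (Derive P3 s).
    change (Derive (fun x => Y x) s) with (Derive Y s).
    change (Derive (fun x => Z x) s) with (Derive Z s).
    rewrite (is_derive_unique _ _ _ d1), (is_derive_unique _ _ _ d2),
      (is_derive_unique _ _ _ d3), (is_derive_unique _ _ _ dY), (is_derive_unique _ _ _ dZ).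
    field. lra.
Qed.

Lemma Rpower_root_conjugate z : 0 < z -> Rpower (Rpower z (1 / (p - 1))) (p - 1) = z.
Proof. intros hz. apply Rpower_root; lra. Qed.

Lemma Rpower_conjugate z : 0 < z -> Rpower z (p / (p - 1)) = Rpower z (1 / (p - 1)) * z.
Proof.
  intros hz. rewrite Rmult_comm, <- Rpower_S by exact hz. f_equal. field. lra.
Qed.

(** For fixed [y] the energy is smallest on the nullcline [z = (b y)^(p-1)]; the
    left-hand side is its value there. *)
Lemma energy_lower y z : 0 < y -> 0 < z ->
  Rpower y (q + 1) / (q + 1) - k * Rpower b (p - 1) * Rpower y p / p <= energy y z.
Proof.
  intros hy hz. unfold energy. rewrite (Rpower_conjugate z hz).
  pose proof (Rpower_tangent p (b * y) (Rpower z (1 / (p - 1))) hp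
    ltac:(apply Rmult_lt_0_compat; assumption) (Rpower_pos _ _)) as h.
  rewrite (Rpower_root_conjugate z hz), <- (Rpower_mult_distr b y) in h by assumption.
  replace (Rpower (Rpower z (1 / (p - 1))) p) with (Rpower z (1 / (p - 1)) * z) in h.
  2:{ rewrite Rpower_mult. rewrite <- Rpower_conjugate by exact hz. f_equal. field. lra. }
  replace (Rpower b p) with (b * Rpower b (p - 1)) in h.
  2:{ rewrite <- Rpower_S by exact hb. f_equal. ring. }
  set (X := Rpower z (1 / (p - 1))) in *. set (Bp := Rpower b (p - 1)) in *.
  set (yp := Rpower y p) in *.
  enough (0 <= / p * (b * Bp * yp - X * z - p * z * (b * y - X))).
  { replace ((p - 1) / p * (X * z)) with (X * z - / p * (X * z)) by (field; lra).
    replace (k * Bp * yp / p) with ((k - b) * Bp * yp / p + / p * (b * Bp * yp)) by (field; lra).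
    replace (b * y * z) with (/ p * (p * z * (b * y))) by (field; lra).
    replace (X * z) with (/ p * (p * z * X)) at 1 by (field; lra). lra. }
  apply Rmult_le_pos; [apply Rlt_le, Rinv_0_lt_compat; lra|lra].
Qed.

(** Both factors compare [b y] with [z^(1/(p-1))], the second one after
    raising to the increasing power [p - 1]. *)
Lemma flow_energy_sign y z : 0 < y -> 0 < z ->
  0 <= (b * y - Rpower z (1 / (p - 1))) * (Rpower (b * y) (p - 1) - z).
Proof.
  intros hy hz. rewrite <- (Rpower_root_conjugate z hz) at 2.
  set (X := Rpower z (1 / (p - 1))).
  assert (hX : 0 < X) by apply Rpower_pos.
  assert (hby : 0 < b * y) by (apply Rmult_lt_0_compat; assumption).
  destruct (Rle_dec X (b * y)).
  - assert (Rpower X (p - 1) <= Rpower (b * y) (p - 1)) by (apply Rle_Rpower_l; lra).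
    apply Rmult_le_pos; lra.
  - assert (Rpower (b * y) (p - 1) <= Rpower X (p - 1)) by (apply Rle_Rpower_l; lra).
    nra.
Qed.

Lemma energy_nonincr (Y Z : R -> R) s t :
  s <= t -> (forall x, s <= x <= t -> flow Y Z x) ->
  energy (Y t) (Z t) <= energy (Y s) (Z s).
Proof.
  intros hst hf.
  eapply (nonincr_of_derive (fun s => energy (Y s) (Z s))); [exact hst| |].
  - intros x hx. apply flow_energy, hf, hx.
  - intros x hx. simpl. destruct (hf x hx) as [hY [hZ _]].
    pose proof (flow_energy_sign _ _ hY hZ). nra.
Qed.

(** When [Y] is small, the term in [Y^p] dominates the one in [Y^(q+1)], and
    the two terms in [z] have a negative sum as soon as [Y' >= 0].  Such times
    exist arbitrarily early, because a positive [Y] that tends to [0] at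
    [-oo] cannot be decreasing near [-oo]. *)
Lemma energy_negative (Y Z : R -> R) (s0 : R) :
  (forall s, s <= s0 -> flow Y Z s) ->
  (forall eps, 0 < eps -> exists S, forall s, s <= S -> Y s < eps) ->
  energy (Y s0) (Z s0) < 0.
Proof.
  intros hf hlim.
  (* Below the threshold [Y^(q-p+1) = C] the term in [Y^p] dominates. *)
  set (C := (q + 1) * ((k - b) * Rpower b (p - 1)) / p).
  assert (hC : 0 < C).
  { apply Rdiv_lt_0_compat; [|lra]. apply Rmult_lt_0_compat; [lra|].
    apply Rmult_lt_0_compat; [lra|apply Rpower_pos]. }
  destruct (hlim (Rpower C (1 / (q - p + 1))) (Rpower_pos _ _)) as [S hS].
  set (s1 := Rmin S s0).
  assert (s1 <= S) by apply Rmin_l. assert (s1 <= s0) by apply Rmin_r.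
  assert (exists s, s <= s1 /\ Rpower (Z s) (1 / (p - 1)) <= b * Y s) as [s [hs hX]].
  { apply Classical_Prop.NNPP. intros hno.
    destruct (hf s1 ltac:(lra)) as [hY1 _].
    destruct (hlim (Y s1) hY1) as [S' hS'].
    set (s2 := Rmin S' s1).
    assert (s2 <= S') by apply Rmin_l. assert (s2 <= s1) by apply Rmin_r.
    specialize (hS' s2 ltac:(lra)).
    assert (Y s1 <= Y s2); [|lra].
    eapply (nonincr_of_derive Y); [lra| |].
    - intros x hx. apply (hf x). lra.
    - intros x hx. simpl. apply Rnot_lt_le. intros hlt. apply hno. exists x. split; lra. }
  apply Rle_lt_trans with (energy (Y s) (Z s)).
  { apply energy_nonincr; [lra|]. intros x hx. apply hf. lra. }
  destruct (hf s ltac:(lra)) as [hY [hZ _]].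
  specialize (hS s ltac:(lra)).
  unfold energy. rewrite (Rpower_conjugate _ hZ).
  assert (hYC : Rpower (Y s) (q - p + 1) < C).
  { rewrite <- (Rpower_root (q - p + 1) C hC) by lra.
    apply Rlt_Rpower_l; lra. }
  replace (Rpower (Y s) (q + 1)) with (Rpower (Y s) (q - p + 1) * Rpower (Y s) p)
    by (rewrite <- Rpower_plus; f_equal; ring).
  set (X := Rpower (Z s) (1 / (p - 1))) in *.
  set (yp := Rpower (Y s) p). assert (hyp : 0 < yp) by apply Rpower_pos.
  assert (h1 : Rpower (Y s) (q - p + 1) * yp / (q + 1) < (k - b) * Rpower b (p - 1) * yp / p).
  { replace ((k - b) * Rpower b (p - 1) * yp / p) with (C * yp / (q + 1)) by (unfold C; field; lra).
    apply Rmult_lt_compat_r; [apply Rinv_0_lt_compat; lra|]. apply Rmult_lt_compat_r; lra. }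
  assert (h2 : (p - 1) / p * (X * Z s) <= b * Y s * Z s).
  { rewrite <- Rmult_assoc. apply Rmult_le_compat_r; [lra|].
    assert (0 < X) by apply Rpower_pos.
    assert ((p - 1) / p <= 1) by (apply Rle_div_l; lra). nra. }
  lra.
Qed.

(** The potential [y^(q+1)/(q+1) - k b^(p-1) y^p / p] vanishes at [0] and tends
    to [+oo], so it is at most [v < 0] only in a compact part of
    [(0, +oo)]. *)
Lemma energy_confines (v : R) : v < 0 ->
  exists A B, 0 < A /\ forall y z, 0 < y -> 0 < z -> energy y z <= v -> A <= y <= B.
Proof.
  intros hv.
  set (K := k * Rpower b (p - 1)).
  assert (hK : 0 < K) by (apply Rmult_lt_0_compat; [lra|apply Rpower_pos]).
  set (A := Rpower (p * (- v) / K) (1 / p)).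
  set (B := Rpower (K * (q + 1) / p) (1 / (q - p + 1))).
  exists A, B. split; [apply Rpower_pos|].
  intros y z hy hz he. pose proof (energy_lower y z hy hz) as hl. fold K in hl.
  pose proof (Rpower_pos y p) as hyp.
  split.
  - apply Rnot_lt_le. intros hlt.
    assert (h : Rpower y p < p * (- v) / K).
    { rewrite <- (Rpower_root p (p * (- v) / K)); [|apply Rdiv_lt_0_compat; nra|lra].
      apply Rlt_Rpower_l; [lra|]. split; assumption. }
    assert (0 < Rpower y (q + 1) / (q + 1)) by (apply Rdiv_lt_0_compat; [apply Rpower_pos|lra]).
    assert (K * Rpower y p / p < - v); [|lra].
    apply Rlt_div_l; [lra|]. apply Rlt_div_r in h; [lra|exact hK].
  - apply Rnot_lt_le. intros hlt.
    assert (h : K * (q + 1) / p < Rpower y (q - p + 1)).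
    { rewrite <- (Rpower_root (q - p + 1) (K * (q + 1) / p)); [| |lra].
      - apply Rlt_Rpower_l; [lra|]. split; [apply Rpower_pos|exact hlt].
      - apply Rdiv_lt_0_compat; nra. }
    replace (Rpower y (q + 1)) with (Rpower y (q - p + 1) * Rpower y p) in hl
      by (rewrite <- Rpower_plus; f_equal; ring).
    assert (K * Rpower y p / p < Rpower y (q - p + 1) * Rpower y p / (q + 1)); [|lra].
    replace (K * Rpower y p / p) with (K * (q + 1) / p * Rpower y p / (q + 1)) by (field; lra).
    apply Rmult_lt_compat_r; [apply Rinv_0_lt_compat; lra|]. apply Rmult_lt_compat_r; lra.
Qed.

Variable a : R.
Hypotheses (ha : 0 < a) (hak : Rpower a (q - p + 1) = k * Rpower b (p - 1)).

Definition equilibrium_z : R := Rpower (b * a) (p - 1).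

Lemma equilibrium_z_root : Rpower equilibrium_z (1 / (p - 1)) = b * a.
Proof. apply Rpower_root'; [apply Rmult_lt_0_compat; assumption|lra]. Qed.

Lemma equilibrium_z_pos : 0 < equilibrium_z.
Proof. apply Rpower_pos. Qed.

(** The value of [Z'] on the nullcline [Y' = 0]: its sign is that of [y - a]. *)
Lemma nullcline_field y : 0 < y ->
  Rpower y q - k * Rpower (b * y) (p - 1) =
  Rpower y (p - 1) * (Rpower y (q - p + 1) - Rpower a (q - p + 1)).
Proof.
  intros hy. rewrite hak, <- (Rpower_mult_distr b y) by assumption.
  replace (Rpower y q) with (Rpower y (p - 1) * Rpower y (q - p + 1))
    by (rewrite <- Rpower_plus; f_equal; ring). ring.
Qed.

Lemma equilibrium_z_eq : k * equilibrium_z = Rpower a q.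
Proof. pose proof (nullcline_field a ha). fold equilibrium_z in H. lra. Qed.

Variables Y Z : R -> R.
Hypothesis hflow : forall s, flow Y Z s.
Hypothesis hY0 : forall eps, 0 < eps -> exists S, forall s, s <= S -> Y s < eps.

Lemma orbit_Y_pos s : 0 < Y s. Proof. apply hflow. Qed.
Lemma orbit_Z_pos s : 0 < Z s. Proof. apply hflow. Qed.
Lemma orbit_dY s : is_derive Y s (b * Y s - Rpower (Z s) (1 / (p - 1))). Proof. apply hflow. Qed.
Lemma orbit_dZ s : is_derive Z s (Rpower (Y s) q - k * Z s). Proof. apply hflow. Qed.

(** Negative energy bounds [Y], and then the second equation, linear in [Z]
    with bounded forcing, bounds [Z].  The interval [[A2, B2]] also contains the
    nullcline value, so that [Y'] can be compared with [Z - (b Y)^(p-1)]. *)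
Lemma orbit_bounds :
  exists A B A2 B2, 0 < A /\ A <= a <= B /\ 0 < A2 /\
   forall s, 0 <= s ->
     A <= Y s <= B /\ A2 <= Z s <= B2 /\ A2 <= Rpower (b * Y s) (p - 1) <= B2.
Proof.
  destruct (energy_confines (energy (Y 0) (Z 0))) as [A0 [B0 [hA0 hAB]]].
  { apply energy_negative; [intros; apply hflow|exact hY0]. }
  set (A := Rmin A0 a). set (B := Rmax B0 a).
  assert (hA : 0 < A) by (apply Rmin_glb_lt; assumption).
  assert (hY : forall s, 0 <= s -> A <= Y s <= B).
  { intros s hs. destruct (hAB (Y s) (Z s) (orbit_Y_pos s) (orbit_Z_pos s)) as [h1 h2].
    - apply energy_nonincr; [exact hs|intros; apply hflow].
    - split; [eapply Rle_trans; [apply Rmin_l|exact h1]|eapply Rle_trans; [exact h2|apply Rmax_l]]. }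
  pose proof (hY 0 ltac:(lra)) as hY00.
  set (A2 := Rmin (Rmin (Z 0) (Rpower A q / k)) (Rpower (b * A) (p - 1))).
  set (B2 := Rmax (Rmax (Z 0) (Rpower B q / k)) (Rpower (b * B) (p - 1))).
  exists A, B, A2, B2.
  split; [exact hA|]. split; [split; [apply Rmin_r|apply Rmax_r]|].
  split.
  { apply Rmin_glb_lt; [|apply Rpower_pos].
    apply Rmin_glb_lt; [apply orbit_Z_pos|]. apply Rdiv_lt_0_compat; [apply Rpower_pos|lra]. }
  intros s hs. split; [exact (hY s hs)|]. split; split.
  - eapply Rle_trans; [apply Rmin_l|].
    set (lo := Rmin (Z 0) (Rpower A q / k)).
    enough (- Z s <= - lo) by lra.
    apply (linear_upper_bound k (- lo) (fun s => - Z s) (fun s => - Rpower (Y s) q) 0 s hs).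
    + intros x hx. replace (- Rpower (Y x) q - k * - Z x) with (- (Rpower (Y x) q - k * Z x)) by ring.
      apply (is_derive_opp Z). apply orbit_dZ.
    + intros x hx. destruct (hY x ltac:(lra)) as [h1 _].
      assert (Rpower A q <= Rpower (Y x) q) by (apply Rle_Rpower_l; lra).
      assert (hlo : lo <= Rpower A q / k) by apply Rmin_r.
      apply Rle_div_r in hlo; lra.
    + assert (lo <= Z 0) by apply Rmin_l. lra.
  - eapply Rle_trans; [|apply Rmax_l].
    set (hi := Rmax (Z 0) (Rpower B q / k)).
    apply (linear_upper_bound k hi Z (fun s => Rpower (Y s) q) 0 s hs).
    + intros x hx. apply orbit_dZ.
    + intros x hx. destruct (hY x ltac:(lra)) as [_ h1].
      assert (Rpower (Y x) q <= Rpower B q) by (apply Rle_Rpower_l; [lra|split; [apply orbit_Y_pos|lra]]).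
      assert (hlo : Rpower B q / k <= hi) by apply Rmax_r.
      apply Rle_div_l in hlo; lra.
    + apply Rmax_l.
  - eapply Rle_trans; [apply Rmin_r|]. destruct (hY s hs).
    apply Rle_Rpower_l; [lra|]. split; [apply Rmult_lt_0_compat; lra|]. apply Rmult_le_compat_l; lra.
  - eapply Rle_trans; [|apply Rmax_r]. destruct (hY s hs).
    apply Rle_Rpower_l; [lra|]. split; [apply Rmult_lt_0_compat; [lra|apply orbit_Y_pos]|]. apply Rmult_le_compat_l; lra.
Qed.

(** The energy alone dissipates only [f^2], with [f = Z - (b Y)^(p-1)]
    the distance to the nullcline.  On the nullcline [f'] has the sign of
    [x = Y - a], so subtracting [ep f x] from the energy produces the
    missing term [- x^2]; for small [ep] the quantity dissipates both [f^2] and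
    [x^2], and both tend to [0]. *)
Lemma orbit_converges eps : 0 < eps ->
  exists S, forall s, S <= s -> Rabs (Y s - a) < eps /\ Rabs (Z s - equilibrium_z) < eps.
Proof.
  intros heps.
  destruct orbit_bounds as [A [B [A2 [B2 [hA [haAB [hA2 hbd]]]]]]].
  destruct (Rpower_slope_bounds (1 / (p - 1)) A2 B2) as [c1 [L1 [hc1 [hL1 hsl1]]]];
    [apply Rdiv_lt_0_compat; lra|exact hA2|].
  destruct (Rpower_slope_bounds (q - p + 1) A B) as [c2 [L2 [hc2 [hL2 hsl2]]]];
    [lra|exact hA|].
  destruct (Rpower_slope_bounds (p - 1) (b * A) (b * B)) as [c3 [L3 [hc3 [hL3 hsl3]]]];
    [lra|apply Rmult_lt_0_compat; assumption|].
  set (f := fun s => Z s - Rpower (b * Y s) (p - 1)).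
  set (x := fun s => Y s - a).
  set (df := fun s => Rpower (Y s) q - k * Z s
    - (p - 1) * Rpower (b * Y s) (p - 1 - 1) * (b * (b * Y s - Rpower (Z s) (1 / (p - 1))))).
  set (dx := fun s => b * Y s - Rpower (Z s) (1 / (p - 1))).
  assert (hx : forall s, is_derive x s (dx s)).
  { intros s. unfold x, dx. replace (b * Y s - _) with (b * Y s - Rpower (Z s) (1 / (p - 1)) - 0) by ring.
    apply (is_derive_minus Y (fun _ => a)); [apply orbit_dY|apply is_derive_Reals, derivable_pt_lim_const]. }
  assert (hf : forall s, is_derive f s (df s)).
  { intros s. unfold f, df. apply (is_derive_minus Z (fun s => Rpower (b * Y s) (p - 1))); [apply orbit_dZ|].
    apply (is_derive_Rpower (fun s => b * Y s) s).
    - apply Rmult_lt_0_compat; [exact hb|apply orbit_Y_pos].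
    - apply (is_derive_scal Y). apply orbit_dY. }
  set (r0 := c2 * Rpower A (p - 1)).
  set (R1 := L2 * Rpower B (p - 1)).
  set (D1 := (p - 1) * Rmax (Rpower (b * A) (p - 1 - 1)) (Rpower (b * B) (p - 1 - 1)) * b).
  assert (hr0 : 0 < r0) by (apply Rmult_lt_0_compat; [lra|apply Rpower_pos]).
  assert (hD1 : 0 < D1).
  { apply Rmult_lt_0_compat; [|lra]. apply Rmult_lt_0_compat; [lra|].
    eapply Rlt_le_trans; [apply Rpower_pos|apply Rmax_l]. }
  (* Both components of the field are linear in the deviations [x] and [f]. *)
  assert (H : forall s, 0 <= s -> exists m r D, c1 <= m <= L1 /\ r0 <= r <= R1 /\
     0 <= D <= D1 /\ dx s = - m * f s /\ df s = r * x s - k * f s + D * m * f s /\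
     Rabs (x s) <= B /\ Rabs (f s) <= B2).
  { intros s hs. destruct (hbd s hs) as [h1 [h2 h3]].
    assert (hbY : 0 < b * Y s) by (apply Rmult_lt_0_compat; [exact hb|apply orbit_Y_pos]).
    destruct (hsl1 (Rpower (b * Y s) (p - 1)) (Z s) h3 h2) as [m [hm hme]].
    rewrite Rpower_root' in hme by lra.
    destruct (hsl2 (Y s) a h1 haAB) as [m2 [hm2 hm2e]].
    exists m, (m2 * Rpower (Y s) (p - 1)), ((p - 1) * Rpower (b * Y s) (p - 1 - 1) * b).
    split; [exact hm|]. split; [split|split; [split|split; [|split; [|split]]]].
    - apply Rmult_le_compat; [lra|apply Rlt_le, Rpower_pos|lra|]. apply Rle_Rpower_l; lra.
    - apply Rmult_le_compat; [lra|apply Rlt_le, Rpower_pos|lra|].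
      apply Rle_Rpower_l; [lra|]. split; [apply orbit_Y_pos|lra].
    - apply Rmult_le_pos; [|lra]. apply Rmult_le_pos; [lra|apply Rlt_le, Rpower_pos].
    - unfold D1. apply Rmult_le_compat_r; [lra|]. apply Rmult_le_compat_l; [lra|].
      apply Rpower_between; [apply Rmult_lt_0_compat; assumption|].
      split; apply Rmult_le_compat_l; lra.
    - unfold dx, f. rewrite hme. ring.
    - unfold df, x, f. rewrite hme.
      pose proof (nullcline_field (Y s) (orbit_Y_pos s)) as hnf. rewrite hm2e in hnf.
      replace (m2 * Rpower (Y s) (p - 1) * (Y s - a)) with (Rpower (Y s) q - k * Rpower (b * Y s) (p - 1))
        by (rewrite hnf; ring).
      ring.
    - unfold x. apply Rabs_le. lra.
    - unfold f. apply Rabs_le. lra. }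
  set (C := D1 * L1 + k).
  set (C' := C ^ 2 / (2 * r0) + L1).
  assert (hC' : 0 < C').
  { apply Rplus_le_lt_0_compat; [|exact hL1].
    apply Rmult_le_pos; [apply pow2_ge_0|apply Rlt_le, Rinv_0_lt_compat; lra]. }
  (* [C'] bounds the coefficient of [f^2] coming from the cross term; this choice
     leaves half of the dissipation [(k - b) c1 f^2]. *)
  set (ep := (k - b) * c1 / (2 * C')).
  assert (hep : 0 < ep).
  { apply Rdiv_lt_0_compat; [apply Rmult_lt_0_compat|]; lra. }
  set (W := fun s => energy (Y s) (Z s) - ep * (f s * x s)).
  set (dW := fun s => - (k - b) * dx s * - f s - ep * (df s * x s + f s * dx s)).
  assert (hW : forall s, is_derive W s (dW s)).
  { intros s. unfold W, dW.
    apply (is_derive_minus (fun s => energy (Y s) (Z s)) (fun s => ep * (f s * x s))).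
    - replace (- f s) with (Rpower (b * Y s) (p - 1) - Z s) by (unfold f; ring).
      apply flow_energy, hflow.
    - apply (is_derive_scal (fun s => f s * x s)).
      apply (is_derive_mult f x s (df s) (dx s)); [apply hf|apply hx|].
      intros; apply Rmult_comm. }
  set (c4 := (k - b) * c1 / 2).
  set (c5 := ep * r0 / 2).
  assert (hc4 : 0 < c4) by (apply Rdiv_lt_0_compat; [apply Rmult_lt_0_compat|]; lra).
  assert (hc5 : 0 < c5) by (apply Rdiv_lt_0_compat; [apply Rmult_lt_0_compat|]; lra).
  assert (hdW : forall s, 0 <= s -> dW s <= - c4 * f s ^ 2 - c5 * x s ^ 2).
  { intros s hs. destruct (H s hs) as [m [r [D [hm [hr [hD [e1 [e2 _]]]]]]]].
    unfold dW. rewrite e1, e2.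
    assert (hDm : 0 <= D * m <= D1 * L1).
    { split; [apply Rmult_le_pos; lra|]. apply Rmult_le_compat; lra. }
    set (F := f s). set (G := x s).
    (* The cross term is absorbed by half of [r0 G^2] and a multiple of [F^2]. *)
    assert (hcr : - (r0 / 2 * G ^ 2 + C ^ 2 / (2 * r0) * F ^ 2) <= (D * m - k) * F * G).
    { assert (hsq : 0 <= (r0 * Rabs G - C * Rabs F) ^ 2 / (2 * r0)).
      { apply Rmult_le_pos; [apply pow2_ge_0|apply Rlt_le, Rinv_0_lt_compat; lra]. }
      replace ((r0 * Rabs G - C * Rabs F) ^ 2 / (2 * r0)) with
        (r0 / 2 * Rabs G ^ 2 + C ^ 2 / (2 * r0) * Rabs F ^ 2 - C * (Rabs F * Rabs G)) in hsq by (field; lra).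
      rewrite !pow2_abs in hsq.
      assert (Rabs ((D * m - k) * F * G) <= C * (Rabs F * Rabs G)).
      { rewrite Rmult_assoc, !Rabs_mult.
        apply Rmult_le_compat_r; [apply Rmult_le_pos; apply Rabs_pos|].
        apply Rabs_le. unfold C. lra. }
      pose proof (Rle_abs (- ((D * m - k) * F * G))). rewrite Rabs_Ropp in H1. lra. }
    pose proof (pow2_ge_0 F) as hF2. pose proof (pow2_ge_0 G) as hG2.
    assert (h1 : (k - b) * c1 * F ^ 2 <= (k - b) * m * F ^ 2).
    { apply Rmult_le_compat_r; [exact hF2|]. apply Rmult_le_compat_l; lra. }
    assert (h2 : r0 * G ^ 2 <= r * G ^ 2) by (apply Rmult_le_compat_r; lra).
    assert (h3 : m * F ^ 2 <= L1 * F ^ 2) by (apply Rmult_le_compat_r; lra).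
    assert (h4 : ep * (r0 / 2 * G ^ 2 - C' * F ^ 2) <= ep * (r * G ^ 2 + (D * m - k) * F * G - m * F ^ 2)).
    { apply Rmult_le_compat_l; [lra|]. unfold C'. lra. }
    assert (h5 : ep * C' = c4) by (unfold ep, c4; field; lra).
    replace (ep * (r0 / 2 * G ^ 2 - C' * F ^ 2)) with (c5 * G ^ 2 - c4 * F ^ 2) in h4
      by (rewrite <- h5; unfold c5; field).
    replace ((k - b) * c1 * F ^ 2) with (2 * c4 * F ^ 2) in h1 by (unfold c4; field).
    replace (- (k - b) * (- m * F) * - F) with (- ((k - b) * m * F ^ 2)) by ring.
    replace ((r * G - k * F + D * m * F) * G + F * (- m * F))
      with (r * G ^ 2 + (D * m - k) * F * G - m * F ^ 2) by ring.
    lra. }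
  assert (hB : 0 < B) by lra.
  assert (hB2 : 0 < B2) by (destruct (hbd 0 ltac:(lra)); lra).
  set (bot := - (k * Rpower b (p - 1) * Rpower B p / p) - ep * (B2 * B)).
  assert (hWB : forall s, 0 <= s -> bot <= W s).
  { intros s hs. destruct (hbd s hs) as [h1 _].
    destruct (H s hs) as [_ [_ [_ [_ [_ [_ [_ [_ [hxb hfb]]]]]]]]].
    pose proof (energy_lower (Y s) (Z s) (orbit_Y_pos s) (orbit_Z_pos s)) as hl.
    assert (0 < Rpower (Y s) (q + 1) / (q + 1)) by (apply Rdiv_lt_0_compat; [apply Rpower_pos|lra]).
    assert (k * Rpower b (p - 1) * Rpower (Y s) p / p <= k * Rpower b (p - 1) * Rpower B p / p).
    { apply Rmult_le_compat_r; [apply Rlt_le, Rinv_0_lt_compat; lra|].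
      apply Rmult_le_compat_l; [apply Rmult_le_pos; [lra|apply Rlt_le, Rpower_pos]|].
      apply Rle_Rpower_l; [lra|]. split; [apply orbit_Y_pos|lra]. }
    assert (Rabs (f s * x s) <= B2 * B).
    { rewrite Rabs_mult. apply Rmult_le_compat; auto using Rabs_pos. }
    pose proof (Rle_abs (f s * x s)).
    assert (ep * (f s * x s) <= ep * (B2 * B)) by (apply Rmult_le_compat_l; lra).
    unfold W, bot. lra. }
  assert (hlimx : forall e, 0 < e -> exists S, 0 <= S /\ forall s, S <= s -> Rabs (x s) < e).
  { apply (dissipation_tendsto_zero W dW x dx 0 c5 (L1 * B2) bot); auto.
    - apply Rmult_lt_0_compat; assumption.
    - intros s hs. specialize (hdW s hs). pose proof (pow2_ge_0 (f s)).
      assert (0 <= c4 * f s ^ 2) by (apply Rmult_le_pos; lra). lra.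
    - intros s hs. destruct (H s hs) as [m [r [D [hm [_ [_ [-> [_ [_ hfb]]]]]]]]].
      rewrite Rabs_mult, Rabs_Ropp, (Rabs_pos_eq m) by lra.
      apply Rmult_le_compat; [lra|apply Rabs_pos|lra|exact hfb]. }
  assert (hlimf : forall e, 0 < e -> exists S, 0 <= S /\ forall s, S <= s -> Rabs (f s) < e).
  { assert (hR1 : 0 < R1) by (apply Rmult_lt_0_compat; [lra|apply Rpower_pos]).
    assert (hDL : 0 < D1 * L1) by (apply Rmult_lt_0_compat; lra).
    apply (dissipation_tendsto_zero W dW f df 0 c4 (R1 * B + C * B2) bot); auto.
    - apply Rplus_lt_0_compat; apply Rmult_lt_0_compat; unfold C; lra.
    - intros s hs. specialize (hdW s hs). pose proof (pow2_ge_0 (x s)).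
      assert (0 <= c5 * x s ^ 2) by (apply Rmult_le_pos; lra). lra.
    - intros s hs. destruct (H s hs) as [m [r [D [hm [hr [hD [_ [-> [hxb hfb]]]]]]]]].
      assert (hDm : 0 <= D * m <= D1 * L1).
      { split; [apply Rmult_le_pos; lra|]. apply Rmult_le_compat; lra. }
      replace (r * x s - k * f s + D * m * f s) with (r * x s + (D * m - k) * f s) by ring.
      eapply Rle_trans; [apply Rabs_triang|]. rewrite !Rabs_mult.
      apply Rplus_le_compat; apply Rmult_le_compat; auto using Rabs_pos.
      + rewrite Rabs_pos_eq; lra.
      + apply Rabs_le. unfold C. lra. }
  destruct (hlimx (Rmin eps (eps / (2 * (L3 * b))))) as [S1 [hS10 hS1]].
  { apply Rmin_glb_lt; [exact heps|]. apply Rdiv_lt_0_compat; [exact heps|].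
    apply Rmult_lt_0_compat; [lra|]. apply Rmult_lt_0_compat; lra. }
  destruct (hlimf (eps / 2)) as [S2 [hS20 hS2]]; [lra|].
  exists (Rmax S1 S2). intros s hs.
  assert (S1 <= Rmax S1 S2) by apply Rmax_l. assert (S2 <= Rmax S1 S2) by apply Rmax_r.
  specialize (hS1 s ltac:(lra)). specialize (hS2 s ltac:(lra)).
  split; [eapply Rlt_le_trans; [exact hS1|apply Rmin_l]|].
  assert (hx2 : Rabs (x s) < eps / (2 * (L3 * b))) by (eapply Rlt_le_trans; [exact hS1|apply Rmin_r]).
  destruct (hbd s ltac:(lra)) as [h1 _].
  destruct (hsl3 (b * Y s) (b * a)) as [m3 [hm3 e3]].
  { split; apply Rmult_le_compat_l; lra. }
  { split; apply Rmult_le_compat_l; lra. }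
  replace (Z s - equilibrium_z) with (f s + m3 * b * x s).
  2:{ unfold f, equilibrium_z, x. replace (m3 * b * (Y s - a)) with (m3 * (b * Y s - b * a)) by ring.
      rewrite <- e3. ring. }
  eapply Rle_lt_trans; [apply Rabs_triang|].
  assert (Rabs (m3 * b * x s) <= eps / 2); [|lra].
  rewrite Rabs_mult. rewrite (Rabs_pos_eq (m3 * b)) by (apply Rmult_le_pos; lra).
  replace (eps / 2) with (L3 * b * (eps / (2 * (L3 * b)))) by (field; lra).
  apply Rmult_le_compat; [apply Rmult_le_pos; lra|apply Rabs_pos| |lra].
  apply Rmult_le_compat_r; lra.
Qed.

Hypothesis hspiral : (b + k) ^ 2 < 4 * (b * k * q / (p - 1)).

(** If [Y - a] never vanished after some time, then
    [rho = (Z - equilibrium_z) / (Y - a)] would solve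
    [rho' = c - (b + k) rho + m rho^2], where [m] and [c] tend to the
    partial derivatives [M0] and [C0] of the nonlinear terms.  As
    [M0 C0 = b k q / (p - 1)], the hypothesis says that the
    quadratic has negative discriminant in the limit, hence eventually. *)
Lemma orbit_meets_level S : exists s, S <= s /\ Y s = a.
Proof.
  apply Classical_Prop.NNPP. intros hno.
  assert (hne : forall s, S <= s -> Y s - a <> 0).
  { intros s hs h. apply hno. exists s. split; [exact hs|lra]. }
  set (M0 := 1 / (p - 1) * Rpower equilibrium_z (1 / (p - 1) - 1)).
  set (C0 := q * Rpower a (q - 1)).
  assert (hM0 : 0 < M0) by (apply Rmult_lt_0_compat; [apply Rdiv_lt_0_compat; lra|apply Rpower_pos]).
  assert (hC0 : 0 < C0) by (apply Rmult_lt_0_compat; [lra|apply Rpower_pos]).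
  assert (hMC : M0 * C0 = b * k * q / (p - 1)).
  { pose proof equilibrium_z_pos as hz. pose proof equilibrium_z_eq as hze.
    assert (e1 : Rpower equilibrium_z (1 / (p - 1) - 1) * equilibrium_z = b * a).
    { rewrite <- equilibrium_z_root, Rmult_comm, <- Rpower_S by exact hz. f_equal. ring. }
    assert (e2 : a * Rpower a (q - 1) = k * equilibrium_z).
    { rewrite hze, <- Rpower_S by exact ha. f_equal. ring. }
    unfold M0, C0.
    replace (Rpower equilibrium_z (1 / (p - 1) - 1)) with (b * a / equilibrium_z) by (rewrite <- e1; field; lra).
    replace (Rpower a (q - 1)) with (k * equilibrium_z / a) by (rewrite <- e2; field; lra).
    field. lra. }
  set (G := 4 * (M0 * C0) - (b + k) ^ 2).
  assert (hG : 0 < G) by (unfold G; rewrite hMC; lra).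
  (* An error [e] in both coefficients costs at most [4 e (M0 + C0) <= G / 2] of
     the gap [G]. *)
  set (e := Rmin (M0 / 2) (G / (8 * (M0 + C0)))).
  assert (he : 0 < e).
  { apply Rmin_glb_lt; [lra|]. apply Rdiv_lt_0_compat; lra. }
  assert (he1 : e <= M0 / 2) by apply Rmin_l.
  assert (he2 : e * (8 * (M0 + C0)) <= G).
  { apply Rle_div_r; [lra|]. apply Rmin_r. }
  set (M1 := M0 - e). set (C1 := C0 - e).
  assert (hM1 : 0 < M1) by (unfold M1; lra).
  assert (hdisc : (b + k) ^ 2 < 4 * (M1 * C1)).
  { unfold M1, C1. replace ((b + k) ^ 2) with (4 * (M0 * C0) - G) by (unfold G; ring). nra. }
  destruct (Rpower_slope_near q a e ha he) as [d1 [hd1 hs1]].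
  destruct (Rpower_slope_near (1 / (p - 1)) equilibrium_z e equilibrium_z_pos he) as [d2 [hd2 hs2]].
  destruct (orbit_converges (Rmin d1 d2)) as [S' hS']; [apply Rmin_glb_lt; assumption|].
  set (T := Rmax S S').
  assert (hTS : S <= T) by apply Rmax_l. assert (hTS' : S' <= T) by apply Rmax_r.
  (* [h] and [eta] complete the square in [C1 - (b + k) rho + M1 rho^2]. *)
  set (h := (b + k) / (2 * M1)).
  set (eta := C1 - (b + k) ^ 2 / (4 * M1)).
  assert (heta : 0 < eta).
  { unfold eta. assert ((b + k) ^ 2 / (4 * M1) < C1); [|lra]. apply Rlt_div_l; lra. }
  set (rho := fun s => (Z s - equilibrium_z) / (Y s - a)).
  set (drho := fun s => ((Rpower (Y s) q - k * Z s) * (Y s - a)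
     - (Z s - equilibrium_z) * (b * Y s - Rpower (Z s) (1 / (p - 1)))) / (Y s - a) ^ 2).
  apply (riccati_no_global_solution rho drho T h (Rmin M1 eta)).
  - apply Rmin_glb_lt; assumption.
  - intros s hs. specialize (hne s ltac:(lra)). unfold rho, drho.
    auto_derive.
    + repeat split; [eexists; apply orbit_dZ|eexists; apply orbit_dY|exact hne].
    + change (Derive (fun x => Y x) s) with (Derive Y s).
      change (Derive (fun x => Z x) s) with (Derive Z s).
      rewrite (is_derive_unique _ _ _ (orbit_dY s)), (is_derive_unique _ _ _ (orbit_dZ s)).
      field. exact hne.
  - intros s hs. specialize (hne s ltac:(lra)).
    destruct (hS' s ltac:(lra)) as [hy hz].
    destruct (hs1 (Y s) (orbit_Y_pos s)) as [c [hc ec]].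
    { eapply Rlt_le_trans; [exact hy|apply Rmin_l]. }
    destruct (hs2 (Z s) (orbit_Z_pos s)) as [m [hm em]].
    { eapply Rlt_le_trans; [exact hz|apply Rmin_r]. }
    fold C0 in hc. fold M0 in hm. apply Rabs_def2 in hc. apply Rabs_def2 in hm.
    rewrite equilibrium_z_root in em.
    assert (hdr : drho s = c - (b + k) * rho s + m * rho s ^ 2).
    { unfold drho, rho.
      replace (Rpower (Y s) q - k * Z s) with (c * (Y s - a) - k * (Z s - equilibrium_z))
        by (rewrite <- ec, <- equilibrium_z_eq; ring).
      replace (b * Y s - Rpower (Z s) (1 / (p - 1))) with (b * (Y s - a) - m * (Z s - equilibrium_z))
        by (rewrite <- em; ring).
      field. exact hne. }
    rewrite hdr.
    pose proof (pow2_ge_0 (rho s)) as hr2. pose proof (pow2_ge_0 (rho s - h)) as hr3.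
    assert (h1 : M1 * rho s ^ 2 <= m * rho s ^ 2) by (apply Rmult_le_compat_r; unfold M1; lra).
    assert (h2 : C1 - (b + k) * rho s + M1 * rho s ^ 2 = eta + M1 * (rho s - h) ^ 2).
    { unfold eta, h. field. lra. }
    assert (h3 : Rmin M1 eta * (rho s - h) ^ 2 <= M1 * (rho s - h) ^ 2)
      by (apply Rmult_le_compat_r; [lra|apply Rmin_l]).
    assert (h4 : Rmin M1 eta <= eta) by apply Rmin_r.
    unfold C1 in h2. lra.
Qed.

(** The vector field is Lipschitz along the orbit, so by backward uniqueness
    an orbit at the equilibrium has always been there, contrary to [Y -> 0] at
    [-oo]. *)
Lemma orbit_not_equilibrium s : ~ (Y s = a /\ Z s = equilibrium_z).
Proof.
  intros [hYs hZs].
  destruct (hY0 a ha) as [S hS].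
  set (s0 := Rmin S s).
  assert (hs0 : s0 <= s) by apply Rmin_r.
  specialize (hS s0 (Rmin_l _ _)).
  destruct (continuity_ab_min Y s0 s hs0) as [ya [hya _]].
  { intros x _. eapply continuity_of_derive, orbit_dY. }
  destruct (continuity_ab_maj Y s0 s hs0) as [yb [hyb _]].
  { intros x _. eapply continuity_of_derive, orbit_dY. }
  destruct (continuity_ab_min Z s0 s hs0) as [za [hza _]].
  { intros x _. eapply continuity_of_derive, orbit_dZ. }
  destruct (continuity_ab_maj Z s0 s hs0) as [zb [hzb _]].
  { intros x _. eapply continuity_of_derive, orbit_dZ. }
  destruct (Rpower_slope_bounds q (Y ya) (Y yb)) as [c1 [L1 [hc1 [hL1 hsl1]]]]; [lra|apply orbit_Y_pos|].
  destruct (Rpower_slope_bounds (1 / (p - 1)) (Z za) (Z zb)) as [c2 [L2 [hc2 [hL2 hsl2]]]];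
    [apply Rdiv_lt_0_compat; lra|apply orbit_Z_pos|].
  set (N := fun x => (Y x - a) ^ 2 + (Z x - equilibrium_z) ^ 2).
  set (dN := fun x => 2 * (Y x - a) * (b * Y x - Rpower (Z x) (1 / (p - 1)))
     + 2 * (Z x - equilibrium_z) * (Rpower (Y x) q - k * Z x)).
  pose proof (backward_gronwall N dN (L1 + L2 + 2 * k) s0 s hs0) as hg.
  assert (hNs : N s = 0) by (unfold N; rewrite hYs, hZs; ring).
  rewrite hNs, Rmult_0_l in hg.
  assert (N s0 * exp ((L1 + L2 + 2 * k) * s0) <= 0).
  { apply hg.
    - intros x hx. unfold N, dN. auto_derive.
      + repeat split; eexists; [apply orbit_dY|apply orbit_dZ].
      + change (Derive (fun x => Y x) x) with (Derive Y x).
        change (Derive (fun x => Z x) x) with (Derive Z x).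
        rewrite (is_derive_unique _ _ _ (orbit_dY x)), (is_derive_unique _ _ _ (orbit_dZ x)). ring.
    - intros x hx. unfold dN, N.
      destruct (hsl1 (Y x) a) as [c [hc ec]].
      { split; [apply hya|apply hyb]; exact hx. }
      { rewrite <- hYs. split; [apply hya|apply hyb]; lra. }
      destruct (hsl2 (Z x) equilibrium_z) as [m [hm em]].
      { split; [apply hza|apply hzb]; exact hx. }
      { rewrite <- hZs. split; [apply hza|apply hzb]; lra. }
      rewrite equilibrium_z_root in em.
      replace (Rpower (Y x) q - k * Z x) with (c * (Y x - a) - k * (Z x - equilibrium_z))
        by (rewrite <- ec, <- equilibrium_z_eq; ring).
      replace (b * Y x - Rpower (Z x) (1 / (p - 1))) with (b * (Y x - a) - m * (Z x - equilibrium_z))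
        by (rewrite <- em; ring).
      set (u := Y x - a). set (v := Z x - equilibrium_z).
      pose proof (pow2_ge_0 u) as hu. pose proof (pow2_ge_0 v) as hv.
      assert (h1 : m * (2 * u * v) <= L2 * (u ^ 2 + v ^ 2)).
      { apply Rle_trans with (m * (u ^ 2 + v ^ 2)).
        - apply Rmult_le_compat_l; [lra|]. pose proof (pow2_ge_0 (u - v)). nra.
        - apply Rmult_le_compat_r; lra. }
      assert (h2 : c * (- (2 * u * v)) <= L1 * (u ^ 2 + v ^ 2)).
      { apply Rle_trans with (c * (u ^ 2 + v ^ 2)).
        - apply Rmult_le_compat_l; [lra|]. pose proof (pow2_ge_0 (u + v)). nra.
        - apply Rmult_le_compat_r; lra. }
      assert (h3 : 0 <= b * u ^ 2) by (apply Rmult_le_pos; lra).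
      assert (h4 : 0 <= k * u ^ 2) by (apply Rmult_le_pos; lra).
      lra. }
  assert (0 < N s0).
  { unfold N. pose proof (pow2_ge_0 (Z s0 - equilibrium_z)).
    assert (0 < (Y s0 - a) ^ 2) by (apply pow2_gt_0; lra). lra. }
  pose proof (exp_pos ((L1 + L2 + 2 * k) * s0)). nra.
Qed.

(** The maximum of [(Y - a)^2] between two times where [Y = a] is positive,
    for otherwise the orbit would sit at the equilibrium. *)
Lemma orbit_stationary S :
  exists s, S < s /\ b * Y s - Rpower (Z s) (1 / (p - 1)) = 0 /\ Y s <> a.
Proof.
  destruct (orbit_meets_level (S + 1)) as [s1 [hs1 e1]].
  destruct (orbit_meets_level (s1 + 1)) as [s2 [hs2 e2]].
  set (f := fun s => (Y s - a) ^ 2).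
  assert (hf : forall s, is_derive f s (2 * (Y s - a) * (b * Y s - Rpower (Z s) (1 / (p - 1))))).
  { intros s. unfold f. auto_derive.
    - eexists; apply orbit_dY.
    - change (Derive (fun x => Y x) s) with (Derive Y s).
      rewrite (is_derive_unique _ _ _ (orbit_dY s)). ring. }
  destruct (continuity_ab_maj f s1 s2 ltac:(lra)) as [c [hc hcs]].
  { intros x _. eapply continuity_of_derive, hf. }
  destruct (Req_dec (Y c) a) as [hca|hca].
  - exfalso.
    assert (hconst : forall x, s1 <= x <= s2 -> Y x = a).
    { intros x hx. specialize (hc x hx). unfold f in hc. rewrite hca in hc.
      apply Rminus_diag_uniq. apply Rsqr_eq_0. unfold Rsqr.
      pose proof (pow2_ge_0 (Y x - a)). nra. }
    set (x := (s1 + s2) / 2).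
    assert (hx : s1 < x < s2) by (unfold x; lra).
    assert (hd : b * Y x - Rpower (Z x) (1 / (p - 1)) = 0).
    { apply (stationary_of_maximum Y _ s1 s2 x (orbit_dY x) hx).
      intros y hy. rewrite (hconst x), (hconst y) by lra. lra. }
    apply (orbit_not_equilibrium x). split; [apply hconst; lra|].
    rewrite (hconst x ltac:(lra)) in hd.
    rewrite <- (Rpower_root_conjugate (Z x) (orbit_Z_pos x)). unfold equilibrium_z. f_equal. lra.
  - exists c.
    assert (hc1 : c <> s1) by (intros ->; contradiction).
    assert (hc2 : c <> s2) by (intros ->; contradiction).
    split; [lra|]. split; [|exact hca].
    assert (h : 2 * (Y c - a) * (b * Y c - Rpower (Z c) (1 / (p - 1))) = 0).
    { apply (stationary_of_maximum f _ s1 s2 c (hf c)); [lra|].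
      intros x hx. apply hc; lra. }
    apply Rmult_integral in h. destruct h as [h|h]; [|exact h].
    exfalso. apply hca. lra.
Qed.

(** At such a point [Y''] has the sign of [- Z'], which on the nullcline is
    that of [a - Y]; thus [Y'] has a simple zero there. *)
Lemma stationary_turns s :
  b * Y s - Rpower (Z s) (1 / (p - 1)) = 0 -> Y s <> a -> turns_at Y s.
Proof.
  intros h0 hne.
  set (h := fun s => b * Y s - Rpower (Z s) (1 / (p - 1))).
  set (l := - (1 / (p - 1) * Rpower (Z s) (1 / (p - 1) - 1) * (Rpower (Y s) q - k * Z s))).
  assert (hh : is_derive h s l).
  { unfold h, l.
    replace (- _) with (b * (b * Y s - Rpower (Z s) (1 / (p - 1)))
      - 1 / (p - 1) * Rpower (Z s) (1 / (p - 1) - 1) * (Rpower (Y s) q - k * Z s)) by (rewrite h0; ring).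
    apply (is_derive_minus (fun s => b * Y s) (fun s => Rpower (Z s) (1 / (p - 1)))).
    - apply (is_derive_scal Y). apply orbit_dY.
    - apply (is_derive_Rpower Z); [apply orbit_Z_pos|apply orbit_dZ]. }
  assert (hZ : Z s = Rpower (b * Y s) (p - 1)).
  { rewrite <- (Rpower_root_conjugate (Z s) (orbit_Z_pos s)) at 1. f_equal. lra. }
  assert (hpos : 0 < 1 / (p - 1) * Rpower (Z s) (1 / (p - 1) - 1)).
  { apply Rmult_lt_0_compat; [apply Rdiv_lt_0_compat; lra|apply Rpower_pos]. }
  pose proof (nullcline_field (Y s) (orbit_Y_pos s)) as hnf. rewrite <- hZ in hnf.
  pose proof (Rpower_pos (Y s) (p - 1)) as hYp.
  pose proof (Rpower_strict_mono (q - p + 1) (Y s) a ltac:(lra) (orbit_Y_pos s) ha) as hm1.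
  pose proof (Rpower_strict_mono (q - p + 1) a (Y s) ltac:(lra) ha (orbit_Y_pos s)) as hm2.
  destruct (Rtotal_order (Y s) a) as [hlt|[heq|hgt]]; [|contradiction|].
  - assert (hl : - l < 0).
    { apply hm1 in hlt. unfold l. rewrite hnf.
      assert (Rpower (Y s) (p - 1) * (Rpower (Y s) (q - p + 1) - Rpower a (q - p + 1)) < 0) by nra.
      nra. }
    destruct (sign_near_simple_zero (fun x => - h x) s (- l)) as [e [he hs]].
    { apply (is_derive_opp h), hh. }
    { exact hl. }
    { unfold h. lra. }
    exists e. split; [exact he|]. right. split; intros x y hx hxy hy.
    + enough (- Y x < - Y y) by lra.
      apply (strict_incr_of_derive (fun x => - Y x) (fun x => - h x)); [exact hxy| |].
      * intros z _. apply (is_derive_opp Y), orbit_dY.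
      * intros z hz. apply hs. lra.
    + apply (strict_incr_of_derive Y h); [exact hxy| |].
      * intros z _. apply orbit_dY.
      * intros z hz. destruct (hs z) as [_ h2]. specialize (h2 ltac:(lra)). lra.
  - assert (hl : l < 0).
    { apply hm2 in hgt. unfold l. rewrite hnf.
      assert (0 < Rpower (Y s) (p - 1) * (Rpower (Y s) (q - p + 1) - Rpower a (q - p + 1))) by nra.
      nra. }
    destruct (sign_near_simple_zero h s l hh hl h0) as [e [he hs]].
    exists e. split; [exact he|]. left. split; intros x y hx hxy hy.
    + apply (strict_incr_of_derive Y h); [exact hxy| |].
      * intros z _. apply orbit_dY.
      * intros z hz. apply hs. lra.
    + enough (- Y x < - Y y) by lra.
      apply (strict_incr_of_derive (fun x => - Y x) (fun x => - h x)); [exact hxy| |].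
      * intros z _. apply (is_derive_opp Y), orbit_dY.
      * intros z hz. destruct (hs z) as [_ h2]. specialize (h2 ltac:(lra)). lra.
Qed.

End System.

(** * The initial value problem *)

Lemma phi_of_pos p v : 0 < v -> phi p v = Rpower v (p - 1).
Proof.
  intros hv. unfold phi. rewrite Rabs_pos_eq by lra.
  rewrite <- Rpower_S by exact hv. f_equal. ring.
Qed.

Lemma phi_opp p v : phi p (- v) = - phi p v.
Proof. unfold phi. rewrite Rabs_Ropp. ring. Qed.

Lemma phi_of_neg p v : v < 0 -> phi p v = - Rpower (- v) (p - 1).
Proof.
  intros hv. rewrite <- phi_of_pos by lra. rewrite phi_opp. ring.
Qed.

Lemma phi_zero p : phi p 0 = 0.
Proof. unfold phi. ring. Qed.

Lemma phi_scale p c v : 0 < c -> phi p (c * v) = Rpower c (p - 1) * phi p v.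
Proof.
  intros hc. destruct (Rtotal_order v 0) as [hv|[->|hv]].
  - rewrite (phi_of_neg p v hv), phi_of_neg by nra.
    replace (- (c * v)) with (c * - v) by ring.
    rewrite <- Rpower_mult_distr by lra. ring.
  - rewrite Rmult_0_r, phi_zero. ring.
  - rewrite (phi_of_pos p v hv), phi_of_pos by nra.
    rewrite <- Rpower_mult_distr by lra. ring.
Qed.

Lemma phi_neg_inv p v : phi p v < 0 -> v < 0.
Proof.
  intros h. destruct (Rtotal_order v 0) as [hv|[->|hv]]; [exact hv| |].
  - rewrite phi_zero in h. lra.
  - rewrite phi_of_pos in h by exact hv. pose proof (Rpower_pos v (p - 1)). lra.
Qed.

Lemma right_derive_at_0_spec (v : R -> R) (l : R) :
  right_derive_at_0 v l <->
  forall eps, 0 < eps -> exists d, 0 < d /\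
    forall h, 0 < h < d -> Rabs ((v h - v 0) / h - l) < eps.
Proof.
  unfold right_derive_at_0. split; intros H.
  - intros eps heps.
    destruct (proj1 (filterlim_locally _ _) H (mkposreal eps heps)) as [d hd].
    exists d. split; [apply cond_pos|]. intros h hh. apply (hd h); [|lra].
    change (Rabs (h - 0) < d). rewrite Rminus_0_r, Rabs_pos_eq; lra.
  - apply filterlim_locally. intros eps.
    destruct (H eps (cond_pos eps)) as [d [hd hh]].
    exists (mkposreal d hd). intros y hy hy0. apply (hh y).
    change (Rabs (y - 0) < d) in hy. rewrite Rminus_0_r, Rabs_pos_eq in hy; lra.
Qed.

Lemma right_derive_at_0_growth (v : R -> R) eps :
  right_derive_at_0 v 0 -> 0 < eps ->
  exists d, 0 < d /\ forall h, 0 < h < d -> Rabs (v h - v 0) < eps * h.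
Proof.
  intros hv heps. destruct (proj1 (right_derive_at_0_spec v 0) hv eps heps) as [d [hd H]].
  exists d. split; [exact hd|]. intros h hh. specialize (H h hh).
  rewrite Rminus_0_r in H. unfold Rdiv in H.
  rewrite Rabs_mult, Rabs_inv, (Rabs_pos_eq h) in H by lra.
  apply Rlt_div_l in H; lra.
Qed.

(** Comparing the increment over [[h/2, h]] with the growth at [0] uses the
    derivative at positive arguments only. *)
Lemma right_derive_not_steep (v : R -> R) (m t0 : R) :
  right_derive_at_0 v 0 -> 0 < m -> 0 < t0 ->
  (forall t, 0 < t <= t0 -> ex_derive v t /\ m <= Derive v t) -> False.
Proof.
  intros hv hm ht0 H.
  (* The increment over [[h/2, h]] is at least [m h / 2], but at most [(3/8) m h]. *)
  destruct (right_derive_at_0_growth v (m / 4) hv ltac:(lra)) as [d [hd hg]].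
  set (h := Rmin t0 (d / 2)).
  assert (h <= t0) by apply Rmin_l. assert (h <= d / 2) by apply Rmin_r.
  assert (0 < h) by (apply Rmin_glb_lt; lra).
  destruct (mean_value v (Derive v) (h / 2) h) as [c [hc hch]]; [lra| |].
  { intros x hx. apply Derive_correct, H. lra. }
  pose proof (hg h ltac:(lra)) as h1. pose proof (hg (h / 2) ltac:(lra)) as h2.
  apply Rabs_def2 in h1. apply Rabs_def2 in h2.
  destruct (H c ltac:(lra)) as [_ hmc].
  assert (m * (h - h / 2) <= Derive v c * (h - h / 2)) by (apply Rmult_le_compat_r; lra).
  assert (0 < m * h) by (apply Rmult_lt_0_compat; assumption). nra.
Qed.

(** The sign makes this quantity positive and increasing for the solutions
    considered. *)
Definition flux (n : nat) (p : R) (w : R -> R) (t : R) : R :=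
  - (Rpower t (INR n - 1) * phi p (Derive w t)).

Lemma radial_eq_flux n p v f t :
  0 < t -> radial_eq n p v f t ->
  is_derive (flux n p v) t (Rpower t (INR n - 1) * f t).
Proof.
  intros ht [_ [hd he]]. unfold flux.
  set (D := Derive (fun s => phi p (Derive v s)) t) in he.
  pose proof (is_derive_Rpower (fun s => s) t 1 (INR n - 1) ht
    (proj2 (is_derive_Reals _ _ _) (derivable_pt_lim_id t))) as d1. simpl in d1.
  pose proof (Derive_correct _ _ hd) as d2. fold D in d2.
  replace (Rpower t (INR n - 1) * f t) with
    (- ((INR n - 1) * Rpower t (INR n - 1 - 1) * 1 * phi p (Derive v t)
       + Rpower t (INR n - 1) * D)).
  - apply (is_derive_opp (fun s => Rpower s (INR n - 1) * phi p (Derive v s))).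
    apply (is_derive_mult (fun s => Rpower s (INR n - 1)) (fun s => phi p (Derive v s)) t _ _ d1 d2).
    intros; apply Rmult_comm.
  - replace (f t) with (- D - (INR n - 1) / t * phi p (Derive v t)) by lra.
    replace (Rpower t (INR n - 1)) with (t * Rpower t (INR n - 1 - 1)).
    + field. lra.
    + rewrite <- Rpower_S by exact ht. f_equal. ring.
Qed.

Section InitialValue.

Variables (n : nat) (p q alpha : R) (w : R -> R).
Hypotheses (hn : (1 <= n)%nat) (hp : 1 < p).
Hypothesis hw : ivp_solution n p q alpha w.

Definition positive_upto (t : R) : Prop := forall s, 0 <= s <= t -> 0 < w s.

Lemma positive_upto_le s t : s <= t -> positive_upto t -> positive_upto s.
Proof. intros hst h x hx. apply h. lra. Qed.

Lemma ivp_radial t : 0 < t -> positive_upto t ->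
  radial_eq n p w (fun s => Rpower s alpha * Rpower (w s) q) t.
Proof. intros ht h. apply hw; assumption. Qed.

Lemma ivp_ex_derive t : 0 < t -> positive_upto t -> ex_derive w t.
Proof. intros ht h. destruct (ivp_radial t ht h) as [hl _]. exact (locally_singleton _ _ hl). Qed.

Lemma ivp_w0 : w 0 = 1. Proof. apply hw. Qed.

Lemma ivp_near_0 : exists d, 0 < d <= 1 /\ forall h, 0 < h < d -> Rabs (w h - 1) < h.
Proof.
  destruct (right_derive_at_0_growth w 1 (proj1 (proj2 hw)) Rlt_0_1) as [d [hd h]].
  exists (Rmin d 1). split; [split; [apply Rmin_glb_lt; lra|apply Rmin_r]|].
  intros x hx. assert (Rmin d 1 <= d) by apply Rmin_l.
  specialize (h x ltac:(lra)). rewrite ivp_w0 in h. lra.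
Qed.

Lemma flux_derive t : 0 < t -> positive_upto t ->
  is_derive (flux n p w) t (Rpower t (INR n - 1) * (Rpower t alpha * Rpower (w t) q)).
Proof. intros ht h. apply (radial_eq_flux n p w _ t ht (ivp_radial t ht h)). Qed.

(** The flux increases strictly, so if it were nonpositive at [t] it would stay
    below a negative constant near [0].  As [n >= 1], this forces [w'] to stay
    above a positive constant there, which contradicts the vanishing right
    derivative at [0]. *)
Lemma flux_pos t : 0 < t -> positive_upto t -> 0 < flux n p w t.
Proof.
  intros ht hpos. apply Rnot_le_lt. intros hle.
  assert (hmono : forall x y, 0 < x -> x < y -> y <= t -> flux n p w x < flux n p w y).
  { intros x y hx hxy hy.
    apply (strict_incr_of_derive (flux n p w)
      (fun t => Rpower t (INR n - 1) * (Rpower t alpha * Rpower (w t) q))); [exact hxy| |].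
    - intros z hz. apply flux_derive; [lra|]. apply (positive_upto_le z t); [lra|exact hpos].
    - intros z hz. repeat apply Rmult_lt_0_compat; apply Rpower_pos. }
  assert (hc : flux n p w (t / 2) < 0) by (specialize (hmono (t / 2) t ltac:(lra) ltac:(lra) ltac:(lra)); lra).
  set (c := - flux n p w (t / 2)).
  apply (right_derive_not_steep w (Rpower c (1 / (p - 1))) (Rmin (t / 2) 1) (proj1 (proj2 hw))).
  - apply Rpower_pos.
  - apply Rmin_glb_lt; lra.
  - intros x [hx hx'].
    assert (x <= t / 2) by (eapply Rle_trans; [exact hx'|apply Rmin_l]).
    assert (hx1 : x <= 1) by (eapply Rle_trans; [exact hx'|apply Rmin_r]).
    split.
    { apply ivp_ex_derive; [exact hx|]. apply (positive_upto_le x t); [lra|exact hpos]. }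
    assert (hfx : flux n p w x <= - c).
    { unfold c. destruct (Req_dec x (t / 2)) as [->|hne]; [lra|].
      specialize (hmono x (t / 2) hx ltac:(lra) ltac:(lra)). lra. }
    unfold flux in hfx.
    assert (hle1 : Rpower x (INR n - 1) <= 1).
    { rewrite <- (Rpower_base_1 (INR n - 1)) at 2. apply Rle_Rpower_l; [|lra].
      apply le_INR in hn. simpl in hn. lra. }
    assert (hphi : c <= phi p (Derive w x)).
    { pose proof (Rpower_pos x (INR n - 1)). assert (0 < c) by (unfold c; lra). nra. }
    assert (hDp : 0 < Derive w x).
    { apply Ropp_lt_cancel. rewrite Ropp_0. apply (phi_neg_inv p). rewrite phi_opp.
      unfold c in hphi. lra. }
    rewrite phi_of_pos in hphi by exact hDp.
    rewrite <- (Rpower_root' (p - 1) (Derive w x) hDp) by lra.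
    apply Rle_Rpower_l; [apply Rlt_le, Rdiv_lt_0_compat; lra|]. unfold c in *; lra.
Qed.

Lemma ivp_derive_neg t : 0 < t -> positive_upto t -> Derive w t < 0.
Proof.
  intros ht hpos. apply (phi_neg_inv p). pose proof (flux_pos t ht hpos) as h. unfold flux in h.
  pose proof (Rpower_pos t (INR n - 1)). nra.
Qed.

Lemma ivp_decreasing s t : 0 < s -> s < t -> positive_upto t -> w t < w s.
Proof.
  intros hs hst hpos. enough (- w s < - w t) by lra.
  apply (strict_incr_of_derive (fun s => - w s) (fun s => - Derive w s)); [exact hst| |].
  - intros x hx. apply (is_derive_opp w), Derive_correct, ivp_ex_derive; [lra|].
    apply (positive_upto_le x t); [lra|exact hpos].
  - intros x hx. assert (Derive w x < 0); [|lra]. apply ivp_derive_neg; [lra|].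
    apply (positive_upto_le x t); [lra|exact hpos].
Qed.

Lemma ivp_le_1 t : 0 < t -> positive_upto t -> w t <= 1.
Proof.
  intros ht hpos. apply Rnot_lt_le. intros hlt.
  destruct ivp_near_0 as [d [hd h]].
  set (s := Rmin (Rmin (d / 2) (t / 2)) (w t - 1)).
  assert (s <= Rmin (d / 2) (t / 2)) by apply Rmin_l.
  assert (Rmin (d / 2) (t / 2) <= d / 2) by apply Rmin_l.
  assert (Rmin (d / 2) (t / 2) <= t / 2) by apply Rmin_r.
  assert (s <= w t - 1) by apply Rmin_r.
  assert (0 < s) by (repeat apply Rmin_glb_lt; lra).
  pose proof (ivp_decreasing s t ltac:(lra) ltac:(lra) hpos).
  specialize (h s ltac:(lra)). apply Rabs_def2 in h. lra.
Qed.

Variables b k : R.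
Hypotheses (hb : 0 < b) (hbk : b < k) (hq : p - 1 < q).
Hypothesis hk : k = INR n - p - b * (p - 1).
Hypothesis hbq : b * q = INR n + alpha - k.

Definition emden_Y (s : R) : R := exp (b * s) * w (exp s).
(** Where [w' < 0] this is [t^((b+1)(p-1)) |w'|^(p-1)], because
    [(b+1)(p-1) = n - 1 - k]; it is written with the flux, whose derivative is
    given by the equation. *)
Definition emden_Z (s : R) : R := exp (- k * s) * flux n p w (exp s).

Lemma emden_flow s : positive_upto (exp s) -> flow p q b k emden_Y emden_Z s.
Proof.
  intros hpos. pose proof (exp_pos s) as hs.
  pose proof (flux_pos _ hs hpos) as hfl. pose proof (flux_derive _ hs hpos) as hfd.
  pose proof (ivp_derive_neg _ hs hpos) as hneg.
  pose proof (Derive_correct _ _ (ivp_ex_derive _ hs hpos)) as hwd.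
  assert (hwp : 0 < w (exp s)) by (apply hpos; lra).
  assert (hYp : 0 < emden_Y s) by (apply Rmult_lt_0_compat; [apply exp_pos|exact hwp]).
  assert (hZp : 0 < emden_Z s) by (apply Rmult_lt_0_compat; [apply exp_pos|exact hfl]).
  assert (hX : Rpower (emden_Z s) (1 / (p - 1)) = exp ((b + 1) * s) * - Derive w (exp s)).
  { unfold emden_Z, flux. rewrite phi_of_neg by exact hneg. rewrite Rpower_exp.
    replace (exp (- k * s) * - (exp ((INR n - 1) * s) * - Rpower (- Derive w (exp s)) (p - 1)))
      with (Rpower (exp ((b + 1) * s)) (p - 1) * Rpower (- Derive w (exp s)) (p - 1)).
    - rewrite Rpower_mult_distr by (try apply exp_pos; lra).
      apply Rpower_root'; [apply Rmult_lt_0_compat; [apply exp_pos|lra]|lra].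
    - rewrite Rpower_exp.
      replace ((p - 1) * ((b + 1) * s)) with (- k * s + (INR n - 1) * s) by (rewrite hk; ring).
      rewrite exp_plus. ring. }
  split; [exact hYp|]. split; [exact hZp|]. split.
  - rewrite hX. unfold emden_Y. auto_derive.
    + exists (Derive w (exp s)); exact hwd.
    + rewrite (Derive_eq w _ _ hwd).
      replace ((b + 1) * s) with (b * s + s) by ring. rewrite exp_plus. ring.
  - replace (Rpower (emden_Y s) q) with (exp (- k * s) * (exp s *
      (Rpower (exp s) (INR n - 1) * (Rpower (exp s) alpha * Rpower (w (exp s)) q)))).
    + unfold emden_Z. auto_derive.
      * eexists; exact hfd.
      * rewrite (Derive_eq _ _ _ hfd). ring.
    + unfold emden_Y. rewrite <- Rpower_mult_distr by (try apply exp_pos; exact hwp).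
      rewrite !Rpower_exp. rewrite <- !Rmult_assoc. f_equal.
      rewrite <- !exp_plus. f_equal. nra.
Qed.

(** Because [w <= 1]. *)
Lemma emden_Y_small s0 : positive_upto (exp s0) ->
  forall eps, 0 < eps -> exists S, forall s, s <= S -> emden_Y s < eps.
Proof.
  intros hpos eps heps. exists (Rmin s0 (ln (eps / 2) / b)). intros s hs.
  assert (s <= s0) by (eapply Rle_trans; [exact hs|apply Rmin_l]).
  assert (hs2 : s <= ln (eps / 2) / b) by (eapply Rle_trans; [exact hs|apply Rmin_r]).
  apply Rle_div_r in hs2; [|exact hb].
  assert (exp (b * s) <= eps / 2).
  { rewrite <- (exp_ln (eps / 2)) by lra.
    destruct (Req_dec (b * s) (ln (eps / 2))) as [->|]; [lra|].
    apply Rlt_le, exp_increasing. lra. }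
  assert (hle : exp s <= exp s0).
  { destruct (Req_dec s s0) as [->|]; [lra|]. apply Rlt_le, exp_increasing. lra. }
  assert (w (exp s) <= 1) by (apply ivp_le_1; [apply exp_pos|apply (positive_upto_le _ _ hle hpos)]).
  assert (0 < w (exp s)) by (apply hpos; pose proof (exp_pos s); lra).
  unfold emden_Y. pose proof (exp_pos (b * s)). nra.
Qed.

(** Up to the first zero [T] of [w] the variables [Y] and [Z] solve the
    system, and the negative energy bounds [Y = t^b w] below by a positive constant;
    by continuity [w] cannot vanish at [T]. *)
Lemma ivp_global_positivity t : 0 <= t -> 0 < w t.
Proof.
  intros ht. apply Classical_Prop.NNPP. intros hno.
  set (E := fun x => 0 <= x /\ positive_upto x).
  destruct ivp_near_0 as [d [hd hd0]].
  assert (hEd : E (d / 2)).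
  { split; [lra|]. intros s hs. destruct (Req_dec s 0) as [->|hs0].
    - rewrite ivp_w0. lra.
    - specialize (hd0 s ltac:(lra)). apply Rabs_def2 in hd0. lra. }
  destruct (completeness E) as [T [hub hlub]].
  { exists t. intros x [hx hpx]. apply Rnot_lt_le. intros hlt. apply hno. apply hpx. lra. }
  { exists (d / 2). exact hEd. }
  assert (hT0 : 0 < T) by (specialize (hub _ hEd); lra).
  assert (hbelow : forall x, x < T -> positive_upto x).
  { intros x hx.
    assert (exists y, E y /\ x < y) as [y [[hy hpy] hxy]].
    { apply Classical_Prop.NNPP. intros hn'.
      assert (T <= x); [|lra]. apply hlub. intros y hy. apply Rnot_lt_le. intros hlt.
      apply hn'. exists y. split; assumption. }
    apply (positive_upto_le x y); [lra|exact hpy]. }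
  assert (hcont : continuous w T) by (apply hw; exact hT0).
  pose proof (proj1 (filterlim_locally _ _) hcont) as hcT.
  assert (hwT : 0 < w T).
  { set (s0 := ln T - 1).
    assert (hs0 : exp s0 < T).
    { rewrite <- (exp_ln T) by exact hT0. apply exp_increasing. unfold s0. lra. }
    assert (hfl : forall s, exp s < T -> flow p q b k emden_Y emden_Z s).
    { intros s hs. apply emden_flow, hbelow, hs. }
    assert (hen : energy p q b k (emden_Y s0) (emden_Z s0) < 0).
    { apply energy_negative; auto.
      - intros s hs. apply hfl. pose proof (exp_le _ _ hs). lra.
      - apply (emden_Y_small s0), hbelow, hs0. }
    destruct (energy_confines p q b k hp hq hb hbk _ hen) as [A [B [hA hAB]]].
    assert (hlow : forall x, exp s0 <= x < T -> A * Rpower T (- b) <= w x).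
    { intros x hx. pose proof (exp_pos s0).
      set (s := ln x). assert (hxs : exp s = x) by (apply exp_ln; lra).
      assert (hss : s0 <= s).
      { unfold s. rewrite <- (ln_exp s0). apply ln_le; lra. }
      destruct (hfl s ltac:(lra)) as [hY [hZ _]].
      destruct (hAB (emden_Y s) (emden_Z s) hY hZ) as [hAY _].
      { apply (energy_nonincr p q b k hp hq hb hbk emden_Y emden_Z s0 s hss).
        intros y hy. apply hfl. pose proof (exp_le y s (proj2 hy)). lra. }
      unfold emden_Y in hAY. rewrite hxs in hAY.
      assert (hTb : exp (b * s) <= Rpower T b).
      { unfold Rpower. apply exp_le. apply Rmult_le_compat_l; [lra|].
        unfold s. apply ln_le; lra. }
      assert (0 < w x) by (apply (hbelow x); lra).
      rewrite Rpower_Ropp. apply Rle_div_l; [apply Rpower_pos|]. nra. }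
    assert (hlim : 0 < A * Rpower T (- b)) by (apply Rmult_lt_0_compat; [exact hA|apply Rpower_pos]).
    destruct (hcT (mkposreal _ hlim)) as [e he].
    pose proof (cond_pos e).
    set (x := Rmax (exp s0) (T - e / 2)).
    assert (exp s0 <= x) by apply Rmax_l. assert (T - e / 2 <= x) by apply Rmax_r.
    assert (x < T) by (apply Rmax_lub_lt; lra).
    assert (hbx : ball T e x) by (change (Rabs (x - T) < e); apply Rabs_def1; lra).
    specialize (he x hbx). change (Rabs (w x - w T) < A * Rpower T (- b)) in he.
    apply Rabs_def2 in he. specialize (hlow x ltac:(lra)). lra. }
  destruct (hcT (mkposreal _ hwT)) as [e he]. pose proof (cond_pos e).
  assert (hE : E (T + e / 2)).
  { split; [lra|]. intros s hs. destruct (Rlt_dec s T) as [hsT|hsT].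
    - apply (hbelow s hsT). lra.
    - assert (hbx : ball T e s) by (change (Rabs (s - T) < e); apply Rabs_def1; lra).
      specialize (he s hbx). change (Rabs (w s - w T) < w T) in he.
      apply Rabs_def2 in he. lra. }
  specialize (hub _ hE). lra.
Qed.

End InitialValue.

(** * Consequences of the parameter conditions *)

(** The quadratic is negative at [c], so [c] lies between the two roots, and
    hence [N] does too. *)
Lemma below_larger_root (N th ga c : R) :
  c ^ 2 - th * c + ga < 0 -> c < N -> N < (th + sqrt (th ^ 2 - 4 * ga)) / 2 ->
  N ^ 2 - th * N + ga < 0.
Proof.
  intros hc hcN hN. set (D := th ^ 2 - 4 * ga) in *.
  assert (hD : (2 * c - th) ^ 2 < D).
  { unfold D. nra. }
  assert (hD0 : 0 < D) by (pose proof (pow2_ge_0 (2 * c - th)); lra).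
  pose proof (sqrt_sqrt D ltac:(lra)) as hs. pose proof (sqrt_lt_R0 D hD0) as hs0.
  set (S := sqrt D) in *.
  assert (- S < 2 * c - th).
  { apply Rnot_le_lt. intros hle. assert (S ^ 2 <= (2 * c - th) ^ 2); [|nra].
    replace ((2 * c - th) ^ 2) with ((th - 2 * c) ^ 2) by ring. apply pow_incr. lra. }
  assert (h : (2 * N - th) ^ 2 < S * S) by nra.
  unfold D in hs. nra.
Qed.

(** With [x = N - p] one has
    [x^2 - theta x + gamma = (b + k)^2 - 4 b k q / (p - 1)], and the lower bound
    on [n] or [q] reads [p b < x].  At [x = p b], where [k = b], this quadratic
    equals [4 b^2 (1 - q / (p - 1)) < 0], so [x] only has to lie below the larger
    root. *)
Lemma admissible_parameters (N p q alpha : R) :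
  1 < p -> 0 <= alpha ->
  (p < N /\
     q > (N * p - N + p + p * alpha) / (N - p) /\
     N - p < (theta p q alpha
                  + sqrt (theta p q alpha ^ 2 - 4 * gamma p q alpha)) / 2) \/
    (p - 1 < q /\
     (p * q + p + p * alpha) / (q - p + 1) < N /\
     N < p + (theta p q alpha
                  + sqrt (theta p q alpha ^ 2 - 4 * gamma p q alpha)) / 2) ->
  let b := beta p q alpha in let k := N - p - b * (p - 1) in
  p - 1 < q /\ 0 < b /\ b < k /\ (b + k) ^ 2 < 4 * (b * k * q / (p - 1)).
Proof.
  intros hp ha hc b k.
  assert (h : p - 1 < q /\ p * q + p + p * alpha < N * (q - p + 1) /\
    N - p < (theta p q alpha + sqrt (theta p q alpha ^ 2 - 4 * gamma p q alpha)) / 2).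
  { destruct hc as [[h1 [h2 h3]]|[h1 [h2 h3]]].
    - assert (h2' : N * p - N + p + p * alpha < q * (N - p)) by (apply Rlt_div_l; lra).
      split; [|split; [lra|exact h3]].
      apply Rnot_le_lt. intros hle.
      assert (q * (N - p) <= (p - 1) * (N - p)) by (apply Rmult_le_compat_r; lra).
      assert (0 <= p * alpha) by (apply Rmult_le_pos; lra). nra.
    - split; [exact h1|]. split; [|lra]. apply Rlt_div_l; lra. }
  destruct h as [hq [hN hup]].
  assert (hm : 0 < q - p + 1) by lra.
  assert (hb : 0 < b) by (apply Rdiv_lt_0_compat; lra).
  assert (hbm : b * (q - p + 1) = p + alpha) by (unfold b, beta; field; lra).
  assert (hpb : p * b < N - p).
  { apply Rmult_lt_reg_r with (q - p + 1); [exact hm|].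
    rewrite Rmult_assoc, hbm. lra. }
  assert (hbk : b < k) by (unfold k; lra).
  split; [exact hq|]. split; [exact hb|]. split; [exact hbk|].
  assert (hid : forall x, x ^ 2 - theta p q alpha * x + gamma p q alpha
     = (x - b * (p - 2)) ^ 2 - 4 * (b * (x - b * (p - 1)) * q / (p - 1))).
  { intros x. unfold theta, gamma. fold b. field. lra. }
  assert (hroot : (N - p) ^ 2 - theta p q alpha * (N - p) + gamma p q alpha < 0).
  { apply (below_larger_root (N - p) _ _ (p * b)); [|exact hpb|exact hup].
    rewrite hid.
    assert (hlt : 1 < q / (p - 1)) by (apply Rlt_div_r; lra).
    replace ((p * b - b * (p - 2)) ^ 2 - 4 * (b * (p * b - b * (p - 1)) * q / (p - 1)))
      with (4 * b ^ 2 * (1 - q / (p - 1))) by (field; lra).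
    assert (0 < b ^ 2) by (apply pow_lt; exact hb). nra. }
  rewrite hid in hroot. unfold k. replace (b + (N - p - b * (p - 1))) with (N - p - b * (p - 2)) by ring.
  lra.
Qed.

(** * The solution curve and its limits *)

Lemma Rlocally_scale (P : R -> Prop) t r : 0 < t -> locally (t * r) P -> locally r (fun s => P (t * s)).
Proof.
  intros ht [e he].
  assert (hd : 0 < e / t) by (apply Rdiv_lt_0_compat; [apply cond_pos|exact ht]).
  exists (mkposreal _ hd). intros s hs. apply he.
  change (Rabs (s - r) < e / t) in hs. change (Rabs (t * s - t * r) < e).
  replace (t * s - t * r) with (t * (s - r)) by ring.
  rewrite Rabs_mult, (Rabs_pos_eq t) by lra.
  apply Rlt_div_r in hs; lra.
Qed.

Lemma is_derive_dilate (v : R -> R) l c t d s :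
  is_derive v (t * s) l -> is_derive (fun s => v (t * s) * c - d) s (t * l * c).
Proof.
  intros h. auto_derive.
  - exists l. exact h.
  - rewrite (Derive_eq _ _ _ h). ring.
Qed.

(** The equation is equivariant under dilation of the variable, under
    multiplication of the unknown by a positive constant, by homogeneity of [phi],
    and under subtraction of a constant. *)
Lemma radial_eq_scale n p v f c t r :
  0 < c -> 0 < t -> r <> 0 ->
  radial_eq n p v f (t * r) ->
  radial_eq n p (fun s => v (t * s) * c - 1)
    (fun s => Rpower (t * c) (p - 1) * t * f (t * s)) r.
Proof.
  intros hc ht hr [hl [hd he]].
  pose proof (Rlocally_scale _ t r ht hl) as hl'.
  assert (hu : forall s, ex_derive v (t * s) ->
    is_derive (fun s : R => v (t * s) * c - 1) s (t * Derive v (t * s) * c)).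
  { intros s hs. apply is_derive_dilate, Derive_correct, hs. }
  assert (hphi : is_derive (fun s : R => phi p (Derive (fun s => v (t * s) * c - 1) s)) r
    (t * Derive (fun s => phi p (Derive v s)) (t * r) * Rpower (t * c) (p - 1))).
  { eapply is_derive_ext_loc; [|apply (is_derive_dilate (fun s => phi p (Derive v s)) _ _ _ 0)].
    - refine (filter_imp (F := locally r) _ _ _ hl'). intros s hs. simpl.
      rewrite (is_derive_unique _ _ _ (hu s hs)).
      replace (t * Derive v (t * s) * c) with (t * c * Derive v (t * s)) by ring.
      rewrite phi_scale by (apply Rmult_lt_0_compat; assumption). ring.
    - apply Derive_correct, hd. }
  split; [|split].
  - refine (filter_imp (F := locally r) _ _ _ hl'). intros s hs. eexists. apply hu, hs.
  - eexists. exact hphi.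
  - rewrite (is_derive_unique _ _ _ hphi).
    rewrite (is_derive_unique _ _ _ (hu r (locally_singleton _ _ hl'))).
    replace (t * Derive v (t * r) * c) with (t * c * Derive v (t * r)) by ring.
    rewrite phi_scale by (apply Rmult_lt_0_compat; assumption).
    transitivity (Rpower (t * c) (p - 1) * t * (Derive (fun s => phi p (Derive v s)) (t * r)
      + (INR n - 1) / (t * r) * phi p (Derive v (t * r)) + f (t * r))); [field; lra|].
    rewrite he. ring.
Qed.

Lemma radial_eq_forcing n p v f g r : f r = g r -> radial_eq n p v f r -> radial_eq n p v g r.
Proof. intros h [h1 [h2 h3]]. split; [exact h1|]. split; [exact h2|]. rewrite <- h. exact h3. Qed.

(** A power [r^(-b)] balances both sides of the equation because
    [b (q - p + 1) = p + alpha]; comparing the coefficients determines the value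
    [k b^(p-1)] of [lambda]. *)
Lemma singular_profile (n : nat) (p q alpha : R) :
  let b := beta p q alpha in let k := INR n - p - b * (p - 1) in
  1 < p -> p - 1 < q -> 0 < b -> 0 < k ->
  Rpower (a0 n p q alpha) (q - p + 1) = k * Rpower b (p - 1) ->
  singular_solution n p q alpha (lambda0 n p q alpha)
    (fun r => Rpower r (- beta p q alpha) - 1).
Proof.
  intros b k hp hq hb hk ha. fold b.
  assert (hbm : b * (q - p + 1) = p + alpha) by (unfold b, beta; field; lra).
  assert (hgt1 : forall M, 1 <= M -> forall r, 0 < r < Rpower M (- (1 / b)) -> M < Rpower r (- b)).
  { intros M hM r hr.
    rewrite <- (Rpower_root (- b) M) by lra.
    replace (1 / - b) with (- (1 / b)) by (field; lra).
    rewrite (Rpower_Ropp _ b), (Rpower_Ropp _ b).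
    apply Rinv_lt_contravar; [apply Rmult_lt_0_compat; apply Rpower_pos|].
    apply Rlt_Rpower_l; lra. }
  split.
  - intros r hr. split.
    { assert (1 < Rpower r (- b)); [|lra]. apply hgt1; [lra|].
      rewrite Rpower_base_1. lra. }
    assert (hu : forall s, 0 < s ->
      is_derive (fun r : R => Rpower r (- b) - 1) s (- b * Rpower s (- b - 1))).
    { intros s hs. replace (- b * Rpower s (- b - 1)) with (- b * Rpower s (- b - 1) - 0) by ring.
      apply (is_derive_minus (fun r => Rpower r (- b)) (fun _ => 1)).
      - apply is_derive_Reals, derivable_pt_lim_power, hs.
      - apply is_derive_Reals, derivable_pt_lim_const. }
    set (e := (- b - 1) * (p - 1)).
    assert (hphi0 : forall s, 0 < s ->
      phi p (Derive (fun r => Rpower r (- b) - 1) s) = - Rpower b (p - 1) * Rpower s e).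
    { intros s hs. rewrite (is_derive_unique _ _ _ (hu s hs)).
      replace (- b * Rpower s (- b - 1)) with (- (b * Rpower s (- b - 1))) by ring.
      rewrite phi_opp, phi_scale by exact hb. rewrite phi_of_pos by apply Rpower_pos.
      rewrite Rpower_mult. fold e. ring. }
    assert (hloc : locally r (fun s => 0 < s)).
    { exists (mkposreal r (proj1 hr)). intros s hs. change (Rabs (s - r) < r) in hs.
      apply Rabs_def2 in hs. lra. }
    assert (hphi : is_derive (fun s : R => phi p (Derive (fun r => Rpower r (- b) - 1) s)) r
      (- Rpower b (p - 1) * (e * Rpower r (e - 1)))).
    { apply (is_derive_ext_loc (fun s => - Rpower b (p - 1) * Rpower s e)).
      - refine (filter_imp (F := locally r) _ _ _ hloc). intros s hs. symmetry. apply hphi0, hs.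
      - apply (is_derive_scal (fun s => Rpower s e)).
        apply is_derive_Reals, derivable_pt_lim_power, hr. }
    split; [|split].
    + refine (filter_imp (F := locally r) _ _ _ hloc). intros s hs. eexists. apply hu, hs.
    + eexists. exact hphi.
    + rewrite (is_derive_unique _ _ _ hphi), hphi0 by lra.
      unfold lambda0. rewrite ha.
      replace (1 + (Rpower r (- b) - 1)) with (Rpower r (- b)) by ring.
      rewrite Rpower_mult.
      replace (Rpower r e) with (r * Rpower r (e - 1)).
      2:{ rewrite <- Rpower_S by lra. f_equal. ring. }
      rewrite (Rmult_assoc (k * _)), <- Rpower_plus.
      replace (alpha + - b * q) with (e - 1).
      2:{ unfold e. replace alpha with (b * (q - p + 1) - p) by lra. ring. }
      unfold k, e. field. lra.
  - left. intros P [M hM]. 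
    assert (hd : 0 < Rpower (Rmax 1 (M + 1)) (- (1 / b))) by apply Rpower_pos.
    exists (mkposreal _ hd). intros r hr hr0. apply hM.
    change (Rabs (r - 0) < Rpower (Rmax 1 (M + 1)) (- (1 / b))) in hr.
    rewrite Rminus_0_r, Rabs_pos_eq in hr by lra.
    pose proof (hgt1 (Rmax 1 (M + 1)) (Rmax_l _ _) r (conj hr0 hr)).
    pose proof (Rmax_r 1 (M + 1)). lra.
Qed.

Section Curve.

Variables (n : nat) (p q alpha : R) (w : R -> R).
Hypotheses (hn : (1 <= n)%nat) (hp : 1 < p) (hq : p - 1 < q).
Hypothesis hw : ivp_solution n p q alpha w.

Section Positive.

Hypothesis hpos : forall t, 0 <= t -> 0 < w t.

Lemma curve_positive_upto t : positive_upto w t.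
Proof. intros s hs. apply hpos. lra. Qed.

Lemma curve_w_decreasing s t : 0 < s -> s < t -> w t < w s.
Proof. intros hs hst. apply (ivp_decreasing n p q alpha w hn hp hw); auto using curve_positive_upto. Qed.

Lemma curve_w_lt_1 t : 0 < t -> w t < 1.
Proof.
  intros ht. apply Rlt_le_trans with (w (t / 2)).
  - apply curve_w_decreasing; lra.
  - apply (ivp_le_1 n p q alpha w hn hp hw); [lra|apply curve_positive_upto].
Qed.

Lemma curve_bvp t : 0 < t ->
  bvp_solution n p q alpha (curve_lambda p q alpha w t) (curve_u w t).
Proof.
  intros ht.
  assert (hwt : 0 < w t) by (apply hpos; lra).
  assert (hiw : 0 < / w t) by (apply Rinv_0_lt_compat; exact hwt).
  assert (hu : curve_u w t 0 = / w t - 1).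
  { unfold curve_u. rewrite Rmult_0_r, (proj1 hw). field. lra. }
  assert (hu1 : curve_u w t 1 = 0).
  { unfold curve_u. rewrite Rmult_1_r. field. lra. }
  split; [apply Rmult_lt_0_compat; apply Rpower_pos|].
  split; [|split; [|split; [|split; [exact hu1|]]]].
  - intros r hr. assert (htr : 0 < t * r) by (apply Rmult_lt_0_compat; lra).
    assert (hlt : t * r < t) by (rewrite <- (Rmult_1_r t) at 2; apply Rmult_lt_compat_l; lra).
    split.
    { unfold curve_u. assert (1 < w (t * r) / w t); [|lra].
      apply Rlt_div_r; [exact hwt|]. rewrite Rmult_1_l. apply curve_w_decreasing; assumption. }
    pose proof (ivp_radial n p q alpha w hw (t * r) htr (curve_positive_upto _)) as h.
    apply (radial_eq_scale n p w _ (/ w t) t r hiw ht ltac:(lra)) in h.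
    refine (radial_eq_forcing n p _ _ _ r _ h). simpl.
    assert (hwr : 0 < w (t * r)) by (apply hpos; lra).
    unfold curve_u, curve_lambda.
    replace (1 + (w (t * r) / w t - 1)) with (w (t * r) * / w t) by (field; lra).
    rewrite <- !Rpower_mult_distr by lra.
    replace (Rpower (/ w t) (p - 1)) with (Rpower (w t) (q - p + 1) * Rpower (/ w t) q).
    2:{ replace (Rpower (/ w t) q) with (Rpower (/ w t) (q - p + 1) * Rpower (/ w t) (p - 1))
          by (rewrite <- Rpower_plus; f_equal; ring).
        rewrite <- Rmult_assoc, Rpower_mult_distr by assumption.
        rewrite Rinv_r, Rpower_base_1 by lra. ring. }
    replace (Rpower t (p + alpha)) with (Rpower t (p - 1) * t * Rpower t alpha).
    2:{ rewrite (Rmult_comm (Rpower t (p - 1))), <- Rpower_S, <- Rpower_plus by exact ht.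
        f_equal. ring. }
    ring.
  - rewrite hu. pose proof (curve_w_lt_1 t ht).
    assert (1 < / w t); [|lra]. rewrite <- Rinv_1. apply Rinv_lt_contravar; lra.
  - apply right_derive_at_0_spec. intros eps heps.
    assert (he : 0 < eps * w t / t).
    { apply Rdiv_lt_0_compat; [apply Rmult_lt_0_compat|]; assumption. }
    destruct (right_derive_at_0_growth w _ (proj1 (proj2 hw)) he) as [d [hd H]].
    exists (d / t). split; [apply Rdiv_lt_0_compat; assumption|].
    intros h [hh hhd]. apply Rlt_div_r in hhd; [|exact ht].
    assert (hth : 0 < t * h) by (apply Rmult_lt_0_compat; assumption).
    specialize (H (t * h) ltac:(lra)).
    unfold curve_u. rewrite Rmult_0_r.
    replace ((w (t * h) / w t - 1 - (w 0 / w t - 1)) / h - 0)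
      with ((w (t * h) - w 0) * (/ w t * / h)) by (field; lra).
    assert (hih : 0 < / h) by (apply Rinv_0_lt_compat; exact hh).
    rewrite Rabs_mult, (Rabs_pos_eq (/ w t * / h)) by (apply Rmult_le_pos; lra).
    replace eps with (eps * w t / t * (t * h) * (/ w t * / h)) by (field; lra).
    apply Rmult_lt_compat_r; [apply Rmult_lt_0_compat; assumption|exact H].
  - assert (hc : continuous (curve_u w t) 1).
    { apply (ex_derive_continuous (V := R_NormedModule)).
      eexists. apply (is_derive_dilate w (Derive w (t * 1)) (/ w t) t 1 1).
      apply Derive_correct, (ivp_ex_derive n p q alpha w hw); [lra|apply curve_positive_upto]. }
    intros P hP. specialize (hc P hP). destruct hc as [d hd].
    exists d. intros y hy _. apply hd, hy.
Qed.

(** As [w] decreases, large [u(0)] means large [t]. *)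
Lemma u0_to_infty_of_eventually (P : R -> Prop) T :
  0 < T -> (forall t, T < t -> P t) -> u0_to_infty w P.
Proof.
  intros hT H. exists (curve_u0 w T). intros t ht hM. apply H.
  apply Rnot_le_lt. intros hle. unfold curve_u0 in hM.
  assert (w T <= w t).
  { destruct (Req_dec t T) as [->|]; [lra|]. apply Rlt_le, curve_w_decreasing; lra. }
  assert (/ w t <= / w T) by (apply Rinv_le_contravar; [apply hpos; lra|assumption]).
  lra.
Qed.

End Positive.

Variables b k a : R.
Hypotheses (hb : 0 < b) (hbk : b < k).
Hypothesis hk : k = INR n - p - b * (p - 1).
Hypothesis hbm : b * (q - p + 1) = p + alpha.
Hypothesis hspiral : (b + k) ^ 2 < 4 * (b * k * q / (p - 1)).
Hypotheses (ha : 0 < a) (hak : Rpower a (q - p + 1) = k * Rpower b (p - 1)).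

Lemma emden_exponent : b * q = INR n + alpha - k.
Proof. rewrite hk. lra. Qed.

Lemma curve_w_pos t : 0 <= t -> 0 < w t.
Proof.
  apply (ivp_global_positivity n p q alpha w hn hp hw b k hb hbk hq hk emden_exponent).
Qed.

Let Y := emden_Y w b.
Let Z := emden_Z n p w k.

Lemma curve_flow s : flow p q b k Y Z s.
Proof.
  apply (emden_flow n p q alpha w hn hp hw b k hk emden_exponent).
  apply curve_positive_upto, curve_w_pos.
Qed.

Lemma curve_Y_small eps : 0 < eps -> exists S, forall s, s <= S -> Y s < eps.
Proof.
  apply (emden_Y_small n p q alpha w hn hp hw b hb 0), curve_positive_upto, curve_w_pos.
Qed.

Lemma curve_Y t : 0 < t -> Y (ln t) = Rpower t b * w t.
Proof. intros ht. unfold Y, emden_Y. rewrite exp_ln by exact ht. reflexivity. Qed.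

Lemma curve_Y_limit eps : 0 < eps ->
  exists T, 0 < T /\ forall t, T < t -> Rabs (Y (ln t) - a) < eps.
Proof.
  intros heps.
  destruct (orbit_converges p q b k hp hq hb hbk a ha hak Y Z curve_flow curve_Y_small eps heps) as [S hS].
  exists (exp S). split; [apply exp_pos|]. intros t ht. apply hS.
  rewrite <- (ln_exp S). apply ln_le; [apply exp_pos|lra].
Qed.

Lemma curve_lambda_Y t : 0 < t -> curve_lambda p q alpha w t = Rpower (Y (ln t)) (q - p + 1).
Proof.
  intros ht. rewrite curve_Y by exact ht.
  rewrite <- Rpower_mult_distr; [|apply Rpower_pos|apply curve_w_pos; lra].
  rewrite Rpower_mult, hbm. reflexivity.
Qed.

Lemma curve_lambda_lt s t : 0 < s -> 0 < t ->
  Y (ln s) < Y (ln t) -> curve_lambda p q alpha w s < curve_lambda p q alpha w t.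
Proof.
  intros hs ht h. rewrite !curve_lambda_Y by assumption.
  apply Rlt_Rpower_l; [lra|]. split; [apply curve_flow|exact h].
Qed.

Lemma curve_lambda_turns s : turns_at Y s -> turns_at (curve_lambda p q alpha w) (exp s).
Proof.
  intros [e [he H]].
  assert (h1 : exp (s - e) < exp s) by (apply exp_increasing; lra).
  assert (h2 : exp s < exp (s + e)) by (apply exp_increasing; lra).
  pose proof (exp_pos (s - e)) as h0.
  set (d := Rmin (exp s - exp (s - e)) (exp (s + e) - exp s)).
  assert (hd1 : d <= exp s - exp (s - e)) by apply Rmin_l.
  assert (hd2 : d <= exp (s + e) - exp s) by apply Rmin_r.
  exists d. split; [apply Rmin_glb_lt; lra|].
  assert (hlow : forall x, exp (s - e) <= x -> s - e <= ln x).
  { intros x hx. rewrite <- (ln_exp (s - e)). apply ln_le; lra. }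
  assert (hup : forall x, 0 < x -> x <= exp (s + e) -> ln x <= s + e).
  { intros x hx hx'. rewrite <- (ln_exp (s + e)). apply ln_le; lra. }
  assert (hmid1 : forall x, 0 < x -> x <= exp s -> ln x <= s).
  { intros x hx hx'. rewrite <- (ln_exp s). apply ln_le; lra. }
  assert (hmid2 : forall x, exp s <= x -> s <= ln x).
  { intros x hx. rewrite <- (ln_exp s). apply ln_le; lra. }
  destruct H as [[H1 H2]|[H1 H2]]; [left|right]; split; intros x y hx hxy hy;
    apply curve_lambda_lt; try lra;
    [apply H1|apply H2|apply H1|apply H2]; try (apply ln_increasing; lra);
    solve [apply hlow; lra|apply hup; lra|apply hmid1; lra|apply hmid2; lra].
Qed.

Lemma curve_infinitely_many_turns : infinitely_many_turns (curve_lambda p q alpha w).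
Proof.
  destruct (injective_sequence_of_unbounded (turns_at Y)) as [tau [hinj htau]].
  { intros S.
    destruct (orbit_stationary p q b k hp hq hb hbk a ha hak Y Z curve_flow curve_Y_small hspiral S)
      as [s [hs [h0 hne]]].
    exists s. split; [exact hs|].
    apply (stationary_turns p q b k hp hq hb a ha hak Y Z curve_flow s h0 hne). }
  exists (fun j => exp (tau j)). split.
  - intros i j h. apply hinj, exp_inv, h.
  - intros j. split; [apply exp_pos|]. apply curve_lambda_turns, htau.
Qed.

Lemma curve_u0_limit : is_lim (curve_u0 w) p_infty p_infty.
Proof.
  apply is_lim_spec. intros M.
  destruct (curve_Y_limit 1 Rlt_0_1) as [T [hT H]].
  set (M' := Rmax 1 ((M + 1) * (a + 1))).
  assert (hM' : 1 <= M') by apply Rmax_l.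
  exists (Rmax T (Rpower M' (1 / b))). intros t ht.
  assert (h1 : T < t) by (eapply Rle_lt_trans; [apply Rmax_l|exact ht]).
  assert (h2 : Rpower M' (1 / b) < t) by (eapply Rle_lt_trans; [apply Rmax_r|exact ht]).
  assert (h3 : M' < Rpower t b).
  { rewrite <- (Rpower_root b M') by lra. apply Rlt_Rpower_l; [exact hb|].
    split; [apply Rpower_pos|exact h2]. }
  specialize (H t h1). rewrite curve_Y in H by lra. apply Rabs_def2 in H.
  assert (hwt : 0 < w t) by (apply curve_w_pos; lra).
  unfold curve_u0.
  assert (M + 1 < 1 / w t); [|lra].
  apply Rlt_div_r; [exact hwt|].
  destruct (Rle_dec (M + 1) 0) as [hneg|hpos'].
  - assert (0 <= - (M + 1) * w t) by (apply Rmult_le_pos; lra). lra.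
  - assert (h4 : (M + 1) * (a + 1) < Rpower t b).
    { eapply Rle_lt_trans; [apply Rmax_r|exact h3]. }
    assert (h5 : (M + 1) * (a + 1) * w t < a + 1).
    { eapply Rlt_trans; [apply Rmult_lt_compat_r; [exact hwt|exact h4]|]. lra. }
    apply Rmult_lt_reg_r with (a + 1); lra.
Qed.

Lemma curve_lambda_limit :
  filterlim (curve_lambda p q alpha w) (u0_to_infty w) (locally (Rpower a (q - p + 1))).
Proof.
  intros P [e he].
  destruct (Rpower_continuity (q - p + 1) a e ha (cond_pos e)) as [d [hd hcont]].
  destruct (curve_Y_limit d hd) as [T [hT H]].
  apply (u0_to_infty_of_eventually curve_w_pos _ T hT).
  intros t ht. apply he. change (Rabs (curve_lambda p q alpha w t - Rpower a (q - p + 1)) < e).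
  rewrite curve_lambda_Y by lra. apply hcont, H, ht.
Qed.

(** [w(tr) / w(t) = r^(-b) Y(ln (tr)) / Y(ln t)], and both values of [Y] tend to
    [a]. *)
Lemma curve_u_limit r : 0 < r ->
  filterlim (fun t => curve_u w t r) (u0_to_infty w) (locally (Rpower r (- b) - 1)).
Proof.
  intros hr P [e he].
  pose proof (cond_pos e) as hepos.
  set (R0 := Rpower r (- b)). assert (hR0 : 0 < R0) by apply Rpower_pos.
  set (eta := Rmin (a / 2) (e * a / (4 * R0))).
  assert (heta : 0 < eta).
  { apply Rmin_glb_lt; [lra|]. apply Rdiv_lt_0_compat; [apply Rmult_lt_0_compat|]; lra. }
  assert (heta1 : eta <= a / 2) by apply Rmin_l.
  assert (heta2 : eta <= e * a / (4 * R0)) by apply Rmin_r.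
  destruct (curve_Y_limit eta heta) as [T [hT H]].
  apply (u0_to_infty_of_eventually curve_w_pos _ (Rmax T (T / r))).
  { eapply Rlt_le_trans; [exact hT|apply Rmax_l]. }
  intros t ht. apply he. change (Rabs (curve_u w t r - (R0 - 1)) < e).
  assert (h1 : T < t) by (eapply Rle_lt_trans; [apply Rmax_l|exact ht]).
  assert (h2 : T / r < t) by (eapply Rle_lt_trans; [apply Rmax_r|exact ht]).
  apply Rlt_div_l in h2; [|exact hr].
  pose proof (H t h1) as hy1. pose proof (H (t * r) h2) as hy2.
  set (y1 := Y (ln t)) in *. set (y2 := Y (ln (t * r))) in *.
  apply Rabs_def2 in hy1. apply Rabs_def2 in hy2.
  assert (hy1pos : a / 2 < y1) by lra.
  assert (hratio : curve_u w t r = R0 * (y2 / y1) - 1).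
  { unfold curve_u, y1, y2, R0. rewrite !curve_Y by lra.
    rewrite <- Rpower_mult_distr, Rpower_Ropp by lra.
    pose proof (Rpower_pos t b). pose proof (Rpower_pos r b).
    assert (0 < w t) by (apply curve_w_pos; lra). field. lra. }
  rewrite hratio.
  replace (R0 * (y2 / y1) - 1 - (R0 - 1)) with (R0 * (y2 - y1) / y1) by (field; lra).
  unfold Rdiv. rewrite !Rabs_mult, Rabs_inv, (Rabs_pos_eq R0), (Rabs_pos_eq y1) by lra.
  apply Rlt_div_l; [lra|].
  assert (hdiff : Rabs (y2 - y1) < 2 * eta) by (apply Rabs_def1; lra).
  assert (h5 : R0 * Rabs (y2 - y1) < R0 * (2 * eta)) by (apply Rmult_lt_compat_l; lra).
  assert (h6 : R0 * (2 * eta) <= e * (a / 2)).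
  { replace (e * (a / 2)) with (R0 * (2 * (e * a / (4 * R0)))) by (field; lra).
    apply Rmult_le_compat_l; lra. }
  assert (h7 : e * (a / 2) <= e * y1) by (apply Rmult_le_compat_l; lra).
  lra.
Qed.

End Curve.

Theorem theorem4p2 (n : nat) (p q alpha : R) (w : R -> R)
  (hn : (1 <= n)%nat) (hp : 1 < p) (hq : 1 < q) (halpha : 0 <= alpha)
  (hcond :
    (p < INR n /\
     q > (INR n * p - INR n + p + p * alpha) / (INR n - p) /\
     INR n - p < (theta p q alpha
                  + sqrt (theta p q alpha ^ 2 - 4 * gamma p q alpha)) / 2) \/
    (p - 1 < q /\
     (p * q + p + p * alpha) / (q - p + 1) < INR n /\
     INR n < p + (theta p q alpha
                  + sqrt (theta p q alpha ^ 2 - 4 * gamma p q alpha)) / 2))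
  (hw : ivp_solution n p q alpha w) :
  (* the curve is defined for all t > 0 and consists of solutions *)
  (forall t, 0 <= t -> 0 < w t) /\
  (forall t, 0 < t ->
     bvp_solution n p q alpha (curve_lambda p q alpha w t) (curve_u w t) /\
     curve_u w t 0 = curve_u0 w t) /\
  infinitely_many_turns (curve_lambda p q alpha w) /\
  (* u(0) -> +oo along the curve, and the limits as u(0) -> +oo *)
  is_lim (curve_u0 w) p_infty p_infty /\
  filterlim (curve_lambda p q alpha w) (u0_to_infty w)
    (locally (lambda0 n p q alpha)) /\
  (forall r, 0 < r <= 1 ->
     filterlim (fun t => curve_u w t r) (u0_to_infty w)
       (locally (Rpower r (- beta p q alpha) - 1))) /\
  singular_solution n p q alpha (lambda0 n p q alpha)
    (fun r => Rpower r (- beta p q alpha) - 1).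
Proof.
  destruct (admissible_parameters (INR n) p q alpha hp halpha hcond) as [hpq [hb [hbk hspiral]]].
  set (b := beta p q alpha) in *. set (k := INR n - p - b * (p - 1)) in *.
  set (a := a0 n p q alpha).
  assert (ha : 0 < a) by apply Rpower_pos.
  assert (hak : Rpower a (q - p + 1) = k * Rpower b (p - 1)).
  { assert (hK : (INR n - p) * Rpower b (p - 1) - (p - 1) * Rpower b p = k * Rpower b (p - 1)).
    { replace (Rpower b p) with (b * Rpower b (p - 1)).
      - unfold k. ring.
      - rewrite <- Rpower_S by exact hb. f_equal. ring. }
    unfold a, a0. fold b. rewrite hK. apply Rpower_root; [|lra].
    apply Rmult_lt_0_compat; [lra|apply Rpower_pos]. }
  assert (hbm : b * (q - p + 1) = p + alpha) by (unfold b, beta; field; lra).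
  assert (hpos : forall t, 0 <= t -> 0 < w t)
    by (apply (curve_w_pos n p q alpha w hn hp hpq hw b k hb hbk eq_refl hbm)).
  split; [exact hpos|].
  split.
  { intros t ht. split; [apply curve_bvp; assumption|].
    unfold curve_u, curve_u0. rewrite Rmult_0_r, (proj1 hw). reflexivity. }
  split; [apply (curve_infinitely_many_turns n p q alpha w hn hp hpq hw b k a hb hbk eq_refl hbm hspiral ha hak)|].
  split; [apply (curve_u0_limit n p q alpha w hn hp hpq hw b k a hb hbk eq_refl hbm ha hak)|].
  split; [apply (curve_lambda_limit n p q alpha w hn hp hpq hw b k a hb hbk eq_refl hbm ha hak)|].
  split; [intros r hr; apply (curve_u_limit n p q alpha w hn hp hpq hw b k a hb hbk eq_refl hbm ha hak); lra|].
  exact (singular_profile n p q alpha hp hpq hb (Rlt_trans _ _ _ hb hbk) hak).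
Qed.
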